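(* Let $v_1=b_0^2\int a_0^{-2}g_0^2$ (the asymptotic variance, up to the factor $4\pi$, of $n^{1/2}(\hat b_{\rm EV}-b_0)$ where $\hat b_{\rm EV}=n^{-1}\mathbf y^T\mathbf y-1$), and let $$\sigma_4^2=b_0^2\Big(\frac{2\nu}{\theta_0}\Big)^2\Big(\int a_0^2\big(h_0-\tfrac{2\nu}{\theta_0}\big)^2\Big)^{-1}.$$ Define $I^4_{\delta,b_0,\theta_0}:=v_1/\sigma_4^2$. Then, with $b_0,\theta_0$ fixed, $$I^4_{\delta,b_0,\theta_0}\longrightarrow \mathrm{ineff}(\nu):=\frac{\sqrt\pi}{2}\left(\frac{2\nu+1}{2\nu}\right)^2\frac{\Gamma(\nu+\frac12)^2\,\Gamma(2\nu+\frac12)}{\Gamma(\nu)^2\,\Gamma(2\nu+1)}\quad\text{as }\delta\to0.$$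
   Context: Fix $\nu\ge1/2$. For $\alpha>0$, $\omega\in\mathbb R$ let $g^*_{\nu,\alpha}(\omega)=C_\nu\alpha^{2\nu}(\alpha^2+\omega^2)^{-(\nu+1/2)}$ with $C_\nu=\Gamma(\nu+\frac12)/(\sqrt\pi\,\Gamma(\nu))$. For $\delta,\theta>0$ and $\lambda\in[-\pi,\pi]$ let $g^\delta_{\nu,\theta}(\lambda)=\sum_{k\in\mathbb Z}g^*_{\nu,\delta\theta}(\lambda+2k\pi)$, $h^\delta_{\nu,\theta}=\partial\log g^\delta_{\nu,\theta}/\partial\theta$, and for $b>0$, $a^\delta_{b,\theta}=\dfrac{b\,g^\delta_{\nu,\theta}}{b\,g^\delta_{\nu,\theta}+(2\pi)^{-1}}$. All integrals $\int$ without limits are over $[-\pi,\pi]$ in $\lambda$. Notation: $b_0,\theta_0>0$, $g_0=g^\delta_{\nu,\theta_0}$, $h_0=h^\delta_{\nu,\theta_0}$, $a_0=a^\delta_{b_0,\theta_0}$. The model is $\mathbf y=\mathbf z+\boldsymbol\varepsilon$ with $\mathbf z=(Z(\delta),\dots,Z(n\delta))^T$, $Z$ a zero-mean stationary Gaussian process with spectral density $b_0g^*_{\nu,\theta_0}$ on $\mathbb R$, and $\boldsymbol\varepsilon\sim N(0,I_n)$ independent of $Z$; $\sigma_4^2$ is (up to $4\pi$) the asymptotic variance of the ML estimator of $b_0$ when the microergodic parameter $c_0=b_0\theta_0^{2\nu}$ is known. *)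

(* Defs.v *)
From Stdlib Require Import Reals Lra ClassicalEpsilon.
Open Scope R_scope.

(* A canonical choice of a value satisfying P (garbage 0 if none exists). *)
Definition the_real (P : R -> Prop) : R := epsilon (inhabits 0%R) P.

Definition series (s : nat -> R) : R := the_real (infinite_sum s).

Definition integral (f : R -> R) (a b : R) : R :=
  the_real (fun I => exists pr : Riemann_integrable f a b, RiemannInt pr = I).

Definition Deriv (F : R -> R) (x : R) : R :=
  the_real (fun l => derivable_pt_lim F x l).

Definition improper_0_inf (f : R -> R) (l : R) : Prop :=
  forall eps, 0 < eps -> exists a0 T0, 0 < a0 /\ 0 < T0 /\
    forall a T, 0 < a < a0 -> T0 < T ->
      exists pr : Riemann_integrable f a T, Rabs (RiemannInt pr - l) < eps.

Definition Gamma (x : R) : R :=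
  the_real (improper_0_inf (fun t => Rpower t (x - 1) * exp (- t))).

Definition C_nu (nu : R) : R := Gamma (nu + /2) / (sqrt PI * Gamma nu).

Definition gstar (nu alpha omega : R) : R :=
  C_nu nu * Rpower alpha (2 * nu) * Rpower (alpha ^ 2 + omega ^ 2) (- (nu + /2)).

(* g^delta_{nu,theta}(lambda) = sum_{k in Z} g*_{nu,delta theta}(lambda + 2 k pi),
   split as k >= 0 and k <= -1. *)
Definition gdelta (nu delta theta lambda : R) : R :=
  series (fun k => gstar nu (delta * theta) (lambda + 2 * INR k * PI)) +
  series (fun k => gstar nu (delta * theta) (lambda - 2 * INR (S k) * PI)).

Definition hdelta (nu delta theta lambda : R) : R :=
  Deriv (fun t => ln (gdelta nu delta t lambda)) theta.

Definition adelta (nu delta b theta lambda : R) : R :=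
  b * gdelta nu delta theta lambda / (b * gdelta nu delta theta lambda + / (2 * PI)).

Definition v1 (nu delta b0 theta0 : R) : R :=
  b0 ^ 2 * integral (fun l => gdelta nu delta theta0 l ^ 2 / adelta nu delta b0 theta0 l ^ 2)
                    (- PI) PI.

Definition sigma4sq (nu delta b0 theta0 : R) : R :=
  b0 ^ 2 * (2 * nu / theta0) ^ 2 *
  / integral (fun l => adelta nu delta b0 theta0 l ^ 2 *
                       (hdelta nu delta theta0 l - 2 * nu / theta0) ^ 2) (- PI) PI.

Definition I4 (nu delta b0 theta0 : R) : R := v1 nu delta b0 theta0 / sigma4sq nu delta b0 theta0.

Definition ineff (nu : R) : R :=
  sqrt PI / 2 * ((2 * nu + 1) / (2 * nu)) ^ 2 *
  (Gamma (nu + /2) ^ 2 * Gamma (2 * nu + /2)) / (Gamma nu ^ 2 * Gamma (2 * nu + 1)).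

(* Main.v *)
Require Import Defs.
From Stdlib Require Import Reals.
From Stdlib Require Import Lra ClassicalEpsilon.
From Coquelicot Require Import Coquelicot.
Open Scope R_scope.

(* With [alpha = delta * theta] and [l = alpha u], only the [k = 0] term of [gdelta] matters as
   [alpha -> 0]: [gdelta ~ (C / alpha) (1 + u^2)^(-(nu + 1/2))], while all other terms together
   are bounded uniformly in [l]. Hence [alpha * v1 -> b^2 C^2 int_R (1 + u^2)^(-(2 nu + 1)) du].
   Term-by-term differentiation makes [2 nu / theta - hdelta] equal to [(2 nu + 1) / theta] times
   a weighted average of [alpha^2 / (alpha^2 + (l + 2 k PI)^2)], which is at most [1 / (1 + u^2)]
   and tends to it, and [adelta -> 1] for fixed [u]; so the information integral divided by
   [alpha] tends to [((2 nu + 1) / theta)^2 int_R (1 + u^2)^(-2) du = ((2 nu + 1) / theta)^2 PI / 2].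
   It remains that [int_R (1 + u^2)^(-s) du = sqrt PI Gamma (s - 1/2) / Gamma s]: both sides
   satisfy the same recurrence in [s] and, by monotonicity on the left and logarithmic convexity
   of [Gamma] on the right, are asymptotic to [sqrt (PI / s)]. *)

(** * Integrals over the half-line *)

(** Both limits come from squeezing between explicit bounds valid for [alpha <= 1]. For [v1] the
    bounds hold on all of [[-PI, PI]]: there [b * gdelta + / (2 * PI)] exceeds its leading term by
    at most a constant, and the cross term stays bounded after integration because the kernel of
    exponent [nu + 1/2 >= 1] is integrable. For the information integral only the upper bound is
    global: at a fixed [l <> 0], [gdelta], and hence [adelta], tends to 0 with [alpha]. Its lower
    bound is confined to [|l| <= alpha U], with [U] chosen before [delta]. The lattice sums take
    [x = alpha^2] as their variable because it is added to every square: moving [x] shifts all bases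
    by the same amount, so one convexity inequality can be summed over the lattice and yields the
    derivative. Series, integrals, derivatives and [Gamma] are all defined by choice, so each needs
    existence and uniqueness before its value can be used. *)

Notation half_line_int f l := (is_RInt_gen (V := R_NormedModule) f (at_right 0) (Rbar_locally p_infty) l).

(** [epsilon] returns an unspecified witness, so only uniqueness pins its value down. *)
Lemma the_real_eq (P : R -> Prop) (l : R) : P l -> (forall l', P l' -> l' = l) -> the_real P = l.
Proof.
intros Hl Hu; apply Hu; unfold the_real; apply epsilon_spec; now exists l.
Qed.

(** On such pairs [a < b] and [[a, b]] lies in the positive axis, so facts about positive reals
    suffice for eventual statements. *)
Lemma half_line_filter (P : R * R -> Prop) :
  (forall a b, 0 < a < 1 -> 1 < b -> P (a, b)) ->
  filter_prod (at_right 0) (Rbar_locally p_infty) P.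
Proof.
intros H.
exists (fun a => 0 < a < 1) (fun b => 1 < b).
- exists (mkposreal 1 Rlt_0_1). intros y Hy Hy0.
  change (Rabs (y - 0) < 1) in Hy. apply Rabs_def2 in Hy; lra.
- exists 1; tauto.
- exact H.
Qed.

(** Links the epsilon form inside [Gamma] to the filter form, for which linearity, comparison and
    the fundamental theorem are available. *)
Lemma half_line_int_improper (f : R -> R) (l : R) :
  half_line_int f l <-> improper_0_inf f l.
Proof.
split.
- intros H eps Heps.
  destruct (H (ball l (mkposreal eps Heps)) (locally_ball _ _)) as [Q S HQ HS HP].
  destruct HQ as [d Hd]. destruct HS as [M HM].
  exists d, (Rmax M 1). split; [apply cond_pos|].
  assert (H1 := Rmax_l M 1). assert (H2 := Rmax_r M 1).
  split; [lra|]. intros a T Ha HT.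
  assert (Qa : Q a).
  { apply Hd; [|apply Ha]. change (Rabs (a - 0) < d). apply Rabs_def1; lra. }
  assert (ST : S T) by (apply HM; lra).
  destruct (HP a T Qa ST) as [y [Hy By]]. simpl in Hy.
  assert (E : ex_RInt f a T) by now exists y.
  exists (ex_RInt_Reals_0 _ _ _ E). rewrite <- RInt_Reals.
  rewrite (is_RInt_unique _ _ _ _ Hy). exact By.
- intros H P [eps HP].
  destruct (H eps (cond_pos eps)) as (a0 & T0 & Ha0 & HT0 & HH).
  exists (fun a => 0 < a < a0) (fun T => T0 < T).
  + exists (mkposreal a0 Ha0). intros y Hy Hy0.
    change (Rabs (y - 0) < a0) in Hy. apply Rabs_def2 in Hy; lra.
  + exists T0; tauto.
  + intros a T Ha HT. destruct (HH a T Ha HT) as [pr Hpr].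
    exists (RInt f a T). split.
    * apply (RInt_correct (V:=R_CompleteNormedModule)). now apply ex_RInt_Reals_1.
    * apply HP. rewrite (RInt_Reals _ _ _ pr). exact Hpr.
Qed.

Lemma half_line_int_unique (f : R -> R) (l l' : R) :
  half_line_int f l -> half_line_int f l' -> l = l'.
Proof.
intros H H'.
rewrite <- (is_RInt_gen_unique (V:=R_CompleteNormedModule) f l H).
now apply (is_RInt_gen_unique (V:=R_CompleteNormedModule)).
Qed.

Lemma half_line_int_ext (f g : R -> R) (l : R) :
  (forall x, 0 < x -> f x = g x) -> half_line_int f l -> half_line_int g l.
Proof.
intros E. apply is_RInt_gen_ext.
apply half_line_filter; intros a b Ha Hb x [Hx _]; simpl in Hx.
rewrite Rmin_left in Hx by lra. apply E; lra.
Qed.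

Lemma half_line_int_lincomb (f g : R -> R) (a b lf lg : R) :
  half_line_int f lf -> half_line_int g lg ->
  half_line_int (fun x => a * f x + b * g x) (a * lf + b * lg).
Proof.
intros Hf Hg. apply (is_RInt_gen_scal _ a) in Hf. apply (is_RInt_gen_scal _ b) in Hg.
exact (is_RInt_gen_plus _ _ _ _ Hf Hg).
Qed.

Lemma half_line_int_le (f g : R -> R) (lf lg : R) :
  (forall x, 0 < x -> 0 <= f x <= g x) -> half_line_int f lf -> half_line_int g lg -> lf <= lg.
Proof.
intros E Hf Hg. apply Rle_trans with (1 := Rle_abs lf).
refine (RInt_gen_norm (V:=R_CompleteNormedModule) f g lf lg _ _ Hf Hg);
  apply half_line_filter; intros a b Ha Hb; simpl; [lra|].
intros x Hx. destruct (E x); [lra|]. unfold norm; simpl; unfold abs; simpl. rewrite Rabs_pos_eq; lra.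
Qed.

Lemma half_line_int_derive (F f : R -> R) (A B : R) :
  (forall x, 0 < x -> is_derive F x (f x)) -> (forall x, 0 < x -> continuous f x) ->
  filterlim F (at_right 0) (locally A) -> is_lim F p_infty B ->
  half_line_int f (B - A).
Proof.
intros HF Hf HA HB.
apply half_line_int_ext with (Derive F).
{ intros x Hx. apply is_derive_unique; auto. }
apply is_RInt_gen_Derive; try assumption;
  apply half_line_filter; intros a b Ha Hb x [Hx _]; simpl in Hx; rewrite Rmin_left in Hx by lra.
- exists (f x). apply HF; lra.
- apply continuous_ext_loc with f; [|apply Hf; lra].
  assert (Hx0 : 0 < x) by lra.
  exists (mkposreal x Hx0). intros y Hy.
  change (Rabs (y - x) < x) in Hy.
  symmetry. apply is_derive_unique, HF. apply Rabs_def2 in Hy; lra.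
Qed.

Lemma ex_RInt_pos_line (f : R -> R) (a b : R) :
  (forall x, 0 < x -> continuous f x) -> 0 < a -> 0 < b -> ex_RInt f a b.
Proof.
intros Hf Ha Hb. apply (ex_RInt_continuous (V:=R_CompleteNormedModule)).
intros z [Hz _]. apply Hf. apply Rlt_le_trans with (2 := Hz). now apply Rmin_glb_lt.
Qed.

Lemma RInt_mono_domain (f : R -> R) (a b a' b' : R) :
  (forall x, 0 < x -> continuous f x) -> (forall x, 0 < x -> 0 <= f x) ->
  0 < a' -> a' <= a -> a <= b -> b <= b' -> RInt f a b <= RInt f a' b'.
Proof.
intros Hc Hp H0 H1 H2 H3.
rewrite <- (RInt_Chasles (V:=R_CompleteNormedModule) f a' a b') by (apply ex_RInt_pos_line; auto; lra).
rewrite <- (RInt_Chasles (V:=R_CompleteNormedModule) f a b b') by (apply ex_RInt_pos_line; auto; lra).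
unfold plus; simpl.
assert (0 <= RInt f a' a) by (apply RInt_ge_0; auto; [apply ex_RInt_pos_line; auto; lra | intros; apply Hp; lra]).
assert (0 <= RInt f b b') by (apply RInt_ge_0; auto; [apply ex_RInt_pos_line; auto; lra | intros; apply Hp; lra]).
lra.
Qed.

(** Truncated integrals of a nonnegative function grow with the interval, so their supremum is the
    improper integral. *)
Lemma half_line_int_bounded (f : R -> R) (M : R) :
  (forall x, 0 < x -> continuous f x) -> (forall x, 0 < x -> 0 <= f x) ->
  (forall a b, 0 < a <= b -> RInt f a b <= M) ->
  exists l, half_line_int f l /\ forall a b, 0 < a <= b -> RInt f a b <= l.
Proof.
intros Hc Hp HM.
destruct (completeness (fun r => exists a b, 0 < a <= b /\ r = RInt f a b)) as [l [Hl1 Hl2]].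
{ exists M. intros r (a & b & Hab & ->). now apply HM. }
{ exists (RInt f 1 1), 1, 1. split; [lra|reflexivity]. }
assert (Hup : forall a b, 0 < a <= b -> RInt f a b <= l).
{ intros a b Hab. apply Hl1. now exists a, b. }
exists l. split; [|exact Hup].
apply half_line_int_improper. intros eps Heps.
(* Either some truncated integral exceeds [l - eps], and so do all larger ones, or [l - eps] is a
   smaller upper bound. *)
destruct (classic (exists a b, 0 < a <= b /\ l - eps < RInt f a b)) as [(a & b & Hab & Hr)|N].
- exists a, b. split; [lra|split;[lra|]]. intros a' b' Ha' Hb'.
  exists (ex_RInt_Reals_0 _ _ _ (ex_RInt_pos_line f a' b' Hc ltac:(lra) ltac:(lra))).
  rewrite <- RInt_Reals.
  assert (RInt f a b <= RInt f a' b') by (apply RInt_mono_domain; auto; lra).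
  assert (RInt f a' b' <= l) by (apply Hup; lra).
  apply Rabs_def1; lra.
- exfalso. assert (l <= l - eps); [|lra]. apply Hl2. intros r (a & b & Hab & ->).
  apply Rnot_lt_le. intros H. apply N. now exists a, b.
Qed.

(** The majorant [g] is given through a primitive [F] with values in [[0, M]], which bounds every
    truncated integral by [M]. *)
Lemma half_line_int_dominated (F f g : R -> R) (M : R) :
  (forall x, 0 < x -> continuous f x) -> (forall x, 0 < x -> 0 <= f x <= g x) ->
  (forall x, 0 < x -> is_derive F x (g x)) -> (forall x, 0 < x -> continuous g x) ->
  (forall x, 0 < x -> 0 <= F x <= M) ->
  exists l, half_line_int f l /\ forall a b, 0 < a <= b -> RInt f a b <= l.
Proof.
intros Hf Hfg HF Hg HM. apply half_line_int_bounded with M; auto.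
{ intros x Hx. now apply Hfg. }
intros a b Hab.
assert (E : is_RInt g a b (minus (F b) (F a))).
{ apply (is_RInt_derive (V:=R_CompleteNormedModule)); intros x; rewrite Rmin_left by lra; intros Hx;
  [apply HF | apply Hg]; lra. }
apply Rle_trans with (RInt g a b).
- apply RInt_le; [lra | apply ex_RInt_pos_line; auto; lra | now exists (minus (F b) (F a)) |].
  intros x Hx. apply Hfg; lra.
- rewrite (is_RInt_unique _ _ _ _ E). unfold minus, plus, opp; simpl.
  assert (H1 := HM a ltac:(lra)). assert (H2 := HM b ltac:(lra)). lra.
Qed.

Lemma half_line_int_pos (f : R -> R) (l : R) :
  (forall x, 0 < x -> continuous f x) -> (forall x, 0 < x -> 0 < f x) ->
  (forall a b, 0 < a <= b -> RInt f a b <= l) -> 0 < l.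
Proof.
intros Hc Hp Hl. apply Rlt_le_trans with (RInt f 1 2); [|apply Hl; lra].
apply RInt_gt_0; [lra | |]; intros x Hx; [apply Hp | apply Hc]; lra.
Qed.

(** * The Gamma function *)

Lemma Rpower_pos (x y : R) : 0 < Rpower x y.
Proof. apply exp_pos. Qed.

Lemma exp_le (x y : R) : x <= y -> exp x <= exp y.
Proof. intros [H | ->]; [left; now apply exp_increasing | right; reflexivity]. Qed.

(** Tangent line of [ln] at [y], multiplied by [y]. Equivalently [t^y exp(-t)] is largest at
    [t = y], the form that controls the Gamma integrand. *)
Lemma ln_le_tangent (y t : R) : 0 < y -> 0 < t -> y * ln t <= y * ln y + t - y.
Proof.
intros Hy Ht.
assert (H := exp_ineq1_le (ln t - ln y)).
unfold Rminus in H. rewrite exp_plus, exp_Ropp, !exp_ln in H by assumption.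
apply (Rmult_le_compat_l y) in H; [|lra].
replace (y * (t * / y)) with t in H by (field; lra). lra.
Qed.

Lemma Gamma_integrand_continuous (x t : R) : 0 < t -> continuous (fun t => Rpower t (x - 1) * exp (- t)) t.
Proof.
intros Ht. apply (ex_derive_continuous (V := R_NormedModule)). unfold Rpower. auto_derive. lra.
Qed.

Lemma Gamma_integrand_pos (x t : R) : 0 < Rpower t (x - 1) * exp (- t).
Proof. apply Rmult_lt_0_compat; apply exp_pos. Qed.

(** One majorant serves both ends: [t^(x-1) exp(-t) <= exp K * t^(x-1) (1+t)^(-(x+1))], whose
    primitive [exp K / x * (t/(1+t))^x] is bounded. *)
Lemma Gamma_correct (x : R) : 0 < x ->
  half_line_int (fun t => Rpower t (x - 1) * exp (- t)) (Gamma x) /\ 0 < Gamma x.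
Proof.
intros Hx.
(* An upper bound for [(x + 1) ln (1 + t) - t]: the tangent inequality at [x + 1] gives
   [(x + 1) ln (x + 1) - x], which is below [K]. *)
set (K := (x + 1) * ln (x + 1) + 1).
destruct (half_line_int_dominated
  (fun t => exp K / x * exp (x * (ln t - ln (1 + t))))
  (fun t => Rpower t (x - 1) * exp (- t))
  (fun t => exp K * exp (x * (ln t - ln (1 + t))) * (/ t - / (1 + t))) (exp K / x)) as [l [Hl Hle]].
- intros t Ht; now apply Gamma_integrand_continuous.
- intros t Ht; split; [left; apply Gamma_integrand_pos|].
  replace (/ t - / (1 + t)) with (/ t * / (1 + t)) by (field; lra).
  rewrite <- (exp_ln t Ht) at 5. rewrite <- (exp_ln (1 + t)) at 2 by lra.
  rewrite <- !exp_Ropp. unfold Rpower. rewrite <- !exp_plus.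
  apply exp_le.
  assert (H := ln_le_tangent (x + 1) (1 + t) ltac:(lra) ltac:(lra)). unfold K. lra.
- intros t Ht. auto_derive; [lra|]. unfold Rminus. field; lra.
- intros t Ht. apply (ex_derive_continuous (V := R_NormedModule)). auto_derive. repeat split; lra.
- intros t Ht. assert (0 < exp K / x) by (apply Rdiv_lt_0_compat; [apply exp_pos | lra]).
  split; [left; apply Rmult_lt_0_compat; [lra | apply exp_pos]|].
  rewrite <- (Rmult_1_r (exp K / x)) at 2; apply Rmult_le_compat_l; [lra|].
  replace 1 with (exp 0) at 2 by apply exp_0. apply exp_le.
  assert (ln t <= ln (1 + t)) by (apply ln_le; lra).
  assert (0 <= x * (ln (1 + t) - ln t)) by (apply Rmult_le_pos; lra). lra.
- assert (E : Gamma x = l).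
  { apply the_real_eq; [now apply half_line_int_improper|].
    intros l' Hl'. apply half_line_int_improper in Hl'. eapply half_line_int_unique; eassumption. }
  rewrite E. split; [exact Hl|].
  apply half_line_int_pos with (fun t => Rpower t (x - 1) * exp (- t)); auto.
  + intros t Ht; now apply Gamma_integrand_continuous.
  + intros t _; apply Gamma_integrand_pos.
Qed.

(** Integration by parts: [t^x exp(-t)] vanishes at both ends. *)
Lemma Gamma_succ (x : R) : 0 < x -> Gamma (x + 1) = x * Gamma x.
Proof.
intros Hx.
destruct (Gamma_correct x Hx) as [H1 _]. destruct (Gamma_correct (x + 1) ltac:(lra)) as [H2 _].
assert (D : half_line_int (fun t => x * (Rpower t (x - 1) * exp (- t)) - Rpower t (x + 1 - 1) * exp (- t)) (0 - 0)).
{ apply half_line_int_derive with (fun t => Rpower t x * exp (- t)).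
  - intros t Ht. unfold Rpower. auto_derive; [lra|].
    replace ((x - 1) * ln t) with (x * ln t - ln t) by ring.
    replace ((x + 1 - 1) * ln t) with (x * ln t) by ring.
    assert (E : exp (x * ln t - ln t) = exp (x * ln t) * / t).
    { unfold Rminus. now rewrite exp_plus, exp_Ropp, exp_ln. }
    rewrite E. field; lra.
  - intros t Ht. apply (ex_derive_continuous (V := R_NormedModule)). unfold Rpower. auto_derive. repeat split; lra.
  - intros P [eps HP]. exists (mkposreal _ (Rpower_pos eps (/ x))). intros t Ht Ht0.
    change (Rabs (t - 0) < Rpower eps (/ x)) in Ht. apply HP.
    change (Rabs (Rpower t x * exp (- t) - 0) < eps).
    rewrite Rminus_0_r in *. rewrite Rabs_pos_eq in Ht by lra.
    assert (P1 := Rpower_pos t x). assert (P2 := exp_pos (- t)).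
    rewrite Rabs_pos_eq by (apply Rmult_le_pos; lra).
    assert (E1 : exp (- t) <= 1) by (rewrite <- exp_0; apply exp_le; lra).
    apply Rle_lt_trans with (Rpower t x).
    + rewrite <- (Rmult_1_r (Rpower t x)) at 2. apply Rmult_le_compat_l; lra.
    + rewrite <- (Rpower_1 eps (cond_pos eps)), <- (Rinv_l x) at 1 by lra.
      rewrite <- Rpower_mult. apply Rlt_Rpower_l; lra.
  (* The maximum of [t^(x+1) exp(-t)] is at most [(x+1)^(x+1)], which leaves a factor [1/t]. *)
  - apply is_lim_le_le_loc with (fun _ => 0) (fun t => Rpower (x + 1) (x + 1) * / t).
    + exists 0. intros t Ht. unfold Rpower. split; [left; apply Rmult_lt_0_compat; apply exp_pos|].
      rewrite <- (exp_ln t Ht) at 3. rewrite <- exp_Ropp, <- !exp_plus. apply exp_le.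
      assert (H := ln_le_tangent (x + 1) t ltac:(lra) ltac:(lra)). lra.
    + apply is_lim_const.
    + replace (Finite 0) with (Rbar_mult (Rpower (x + 1) (x + 1)) 0) by (simpl; f_equal; ring).
      apply is_lim_scal_l. apply (is_lim_inv (fun t => t) p_infty p_infty); [apply is_lim_id | easy]. }
assert (M := half_line_int_lincomb _ _ x (- (1)) _ _ H1 H2).
apply half_line_int_ext with (g := fun t => x * (Rpower t (x - 1) * exp (- t)) - Rpower t (x + 1 - 1) * exp (- t)) in M;
  [|intros; ring].
assert (U := half_line_int_unique _ _ _ D M). lra.
Qed.

(** Logarithmic convexity at a midpoint, by integrating [2 sqrt t <= e + t / e] against the
    integrand of [Gamma (s - / 2)]. *)
Lemma Gamma_midpoint (s : R) : / 2 < s -> Gamma s ^ 2 <= Gamma (s - / 2) * Gamma (s + / 2).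
Proof.
intros Hs.
destruct (Gamma_correct s ltac:(lra)) as [H0 P0].
destruct (Gamma_correct (s - / 2) ltac:(lra)) as [H1 P1].
destruct (Gamma_correct (s + / 2) ltac:(lra)) as [H2 P2].
(* With this [e] the first term on the right of [L] equals [Gamma s], which leaves exactly the
   claim. *)
set (e := Gamma s / Gamma (s - / 2)).
assert (He : 0 < e) by (apply Rdiv_lt_0_compat; lra).
assert (L : 2 * Gamma s <= e * Gamma (s - / 2) + / e * Gamma (s + / 2)).
{ apply (half_line_int_le (fun t => 2 * (Rpower t (s - 1) * exp (- t)))
   (fun t => e * (Rpower t (s - / 2 - 1) * exp (- t)) + / e * (Rpower t (s + / 2 - 1) * exp (- t)))).
  - intros t Ht. split; [left; apply Rmult_lt_0_compat; [lra | apply Gamma_integrand_pos]|].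
    replace (s - 1) with (s - / 2 - 1 + / 2) by lra.
    replace (s + / 2 - 1) with (s - / 2 - 1 + / 2 + / 2) by lra.
    rewrite !Rpower_plus. set (y := Rpower t (/ 2)).
    assert (Hp := Gamma_integrand_pos (s - / 2) t).
    apply Rminus_le_0.
    replace (_ - _) with ((Rpower t (s - / 2 - 1) * exp (- t)) * ((y - e) ^ 2 * / e)) by (unfold Rminus; field; lra).
    apply Rmult_le_pos; [lra|]. apply Rmult_le_pos; [apply pow2_ge_0 | left; now apply Rinv_0_lt_compat].
  - exact (is_RInt_gen_scal _ 2 _ H0).
  - now apply half_line_int_lincomb. }
unfold e in L.
replace (Gamma s / Gamma (s - / 2) * Gamma (s - / 2)) with (Gamma s) in L by (field; lra).
apply (Rmult_le_compat_l (Gamma s)) in L; [|lra].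
replace (Gamma s * (Gamma s + / (Gamma s / Gamma (s - / 2)) * Gamma (s + / 2)))
  with (Gamma s ^ 2 + Gamma (s - / 2) * Gamma (s + / 2)) in L by (field; lra).
lra.
Qed.

(** * The integral of [(1 + u^2)^(-s)] *)

Lemma Rpower_opp_le (a b c : R) : 0 <= c -> 0 < a <= b -> Rpower b (- c) <= Rpower a (- c).
Proof.
intros Hc Hab. apply exp_le.
assert (ln a <= ln b) by (apply ln_le; lra).
assert (0 <= c * (ln b - ln a)) by (apply Rmult_le_pos; lra). lra.
Qed.

Lemma Rpower_opp_1 (x : R) : 0 < x -> Rpower x (- (1)) = / x.
Proof. intros Hx. now rewrite Rpower_Ropp, Rpower_1. Qed.

Lemma Rpower_sq_opp_half (y : R) : 0 < y -> Rpower (y ^ 2) (- / 2) = / y.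
Proof.
intros Hy. rewrite Rpower_Ropp. rewrite <- Rpower_pow by assumption. rewrite Rpower_mult.
replace (INR 2 * / 2) with 1 by (simpl; field). now rewrite Rpower_1.
Qed.

Definition cauchy_kernel (s u : R) : R := Rpower (1 + u ^ 2) (- s).

Lemma cauchy_kernel_pos (s u : R) : 0 < cauchy_kernel s u.
Proof. apply exp_pos. Qed.

Lemma one_plus_sq_ge (u : R) : 1 <= 1 + u ^ 2.
Proof. assert (H := pow2_ge_0 u). lra. Qed.

Lemma cauchy_kernel_continuous (s u : R) : continuous (cauchy_kernel s) u.
Proof.
apply (ex_derive_continuous (V := R_NormedModule)). unfold cauchy_kernel, Rpower. auto_derive.
assert (H := one_plus_sq_ge u). simpl in H; lra.
Qed.

Lemma ex_RInt_cauchy_kernel (s a b : R) : ex_RInt (cauchy_kernel s) a b.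
Proof.
apply (ex_RInt_continuous (V := R_CompleteNormedModule)). intros; apply cauchy_kernel_continuous.
Qed.

Lemma cauchy_kernel_antitone (s t u : R) : s <= t -> cauchy_kernel t u <= cauchy_kernel s u.
Proof.
intros Hst. apply exp_le.
assert (0 <= ln (1 + u ^ 2)). { rewrite <- ln_1. apply ln_le; [lra | apply one_plus_sq_ge]. }
assert (0 <= (t - s) * ln (1 + u ^ 2)) by (apply Rmult_le_pos; lra). lra.
Qed.

Lemma cauchy_kernel_1 (u : R) : cauchy_kernel 1 u = / (1 + u ^ 2).
Proof. apply Rpower_opp_1. assert (H := one_plus_sq_ge u). lra. Qed.

Lemma cauchy_kernel_le_1 (s u : R) : 0 <= s -> cauchy_kernel s u <= 1.
Proof.
intros Hs. apply Rle_trans with (cauchy_kernel 0 u); [now apply cauchy_kernel_antitone|].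
unfold cauchy_kernel. rewrite Ropp_0, Rpower_O; [lra|]. assert (H := one_plus_sq_ge u). lra.
Qed.

Lemma is_derive_atan_kernel (u : R) : is_derive atan u (cauchy_kernel 1 u).
Proof. rewrite cauchy_kernel_1. apply is_derive_Reals. apply derivable_pt_lim_atan. Qed.

Lemma filterlim_at_right_continuous (F : R -> R) (x : R) :
  continuous F x -> filterlim F (at_right x) (locally (F x)).
Proof. intros H. eapply filterlim_filter_le_1; [apply (filter_le_within _) | exact H]. Qed.

Lemma is_lim_inv_p : is_lim Rinv p_infty 0.
Proof. apply (is_lim_inv (fun t => t) p_infty p_infty); [apply is_lim_id | easy]. Qed.

(** Half of the integral over the whole line, by evenness; hence the factors 2 further on. *)
Definition cauchy_int (s : R) : R :=
  RInt_gen (V := R_CompleteNormedModule) (cauchy_kernel s) (at_right 0) (Rbar_locally p_infty).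

(** For [s >= 1] the kernel lies below that of exponent 1, whose primitive [atan] is bounded. *)
Lemma cauchy_int_correct (s : R) : 1 <= s ->
  half_line_int (cauchy_kernel s) (cauchy_int s) /\
  forall a b, 0 < a <= b -> RInt (cauchy_kernel s) a b <= cauchy_int s.
Proof.
intros Hs.
destruct (half_line_int_dominated atan (cauchy_kernel s) (cauchy_kernel 1) (PI / 2)) as [l [Hl Hle]].
- intros; apply cauchy_kernel_continuous.
- intros u _; split; [left; apply cauchy_kernel_pos | now apply cauchy_kernel_antitone].
- intros u _; apply is_derive_atan_kernel.
- intros; apply cauchy_kernel_continuous.
- intros u Hu. split; [|left; apply atan_bound].
  left. rewrite <- atan_0. now apply atan_increasing.
- assert (E : cauchy_int s = l) by exact (is_RInt_gen_unique (V := R_CompleteNormedModule) _ _ Hl).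
  rewrite E. now split.
Qed.

Lemma cauchy_int_pos (s : R) : 1 <= s -> 0 < cauchy_int s.
Proof.
intros Hs. apply half_line_int_pos with (cauchy_kernel s).
- intros; apply cauchy_kernel_continuous.
- intros; apply cauchy_kernel_pos.
- now apply cauchy_int_correct.
Qed.

Lemma RInt_cauchy_le (s T : R) : 1 <= s -> 0 < T -> RInt (cauchy_kernel s) 0 T <= cauchy_int s.
Proof.
intros Hs HT. apply Rle_plus_epsilon. intros eps Heps.
(* The improper integral starts just above 0; since the kernel is at most 1, the missing piece
   [[0, a]] costs at most [eps]. *)
set (a := Rmin eps T).
assert (Ha : 0 < a) by now apply Rmin_glb_lt.
assert (H1 : a <= eps) by apply Rmin_l. assert (H2 : a <= T) by apply Rmin_r.
rewrite <- (RInt_Chasles (V := R_CompleteNormedModule) _ 0 a T) by apply ex_RInt_cauchy_kernel.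
assert (RInt (cauchy_kernel s) 0 a <= RInt (fun _ => 1) 0 a).
{ apply RInt_le; [lra | apply ex_RInt_cauchy_kernel | apply ex_RInt_const |].
  intros; apply cauchy_kernel_le_1; lra. }
rewrite RInt_const in H. unfold scal in H; simpl in H; unfold mult in H; simpl in H.
assert (H3 := proj2 (cauchy_int_correct s Hs) a T ltac:(lra)).
unfold plus; simpl. lra.
Qed.

Lemma RInt_cauchy_lim (s : R) : 1 <= s -> is_lim (fun T => RInt (cauchy_kernel s) 0 T) p_infty (cauchy_int s).
Proof.
intros Hs P [eps HP].
destruct (proj1 (half_line_int_improper _ _) (proj1 (cauchy_int_correct s Hs)) eps (cond_pos eps))
  as (a0 & T0 & Ha0 & HT0 & H).
exists T0. intros T HT. apply HP.
set (a := Rmin (a0 / 2) T).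
assert (Ha : 0 < a) by (apply Rmin_glb_lt; lra).
assert (H1 : a <= a0 / 2) by apply Rmin_l. assert (H2 : a <= T) by apply Rmin_r.
destruct (H a T ltac:(lra) HT) as [pr Hpr]. rewrite <- RInt_Reals in Hpr.
assert (H3 := RInt_cauchy_le s T Hs ltac:(lra)).
assert (H4 : RInt (cauchy_kernel s) a T <= RInt (cauchy_kernel s) 0 T).
{ rewrite <- (RInt_Chasles (V := R_CompleteNormedModule) _ 0 a T) by apply ex_RInt_cauchy_kernel.
  assert (0 <= RInt (cauchy_kernel s) 0 a).
  { apply RInt_ge_0; [lra | apply ex_RInt_cauchy_kernel | intros; left; apply cauchy_kernel_pos]. }
  unfold plus; simpl. lra. }
change (Rabs (RInt (cauchy_kernel s) 0 T - cauchy_int s) < eps).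
apply Rabs_def2 in Hpr. apply Rabs_def1; assert (0 < eps) by apply cond_pos; lra.
Qed.

Lemma cauchy_int_antitone (s t : R) : 1 <= s <= t -> cauchy_int t <= cauchy_int s.
Proof.
intros Hst. apply half_line_int_le with (cauchy_kernel t) (cauchy_kernel s).
- intros u _. split; [left; apply cauchy_kernel_pos | now apply cauchy_kernel_antitone].
- apply cauchy_int_correct; lra.
- apply cauchy_int_correct; lra.
Qed.

(** Writing [u^2 = (1 + u^2) - 1] makes the derivative a combination of two neighbouring kernels,
    the source of the recurrence in [s]. *)
Lemma is_derive_cauchy_primitive (s u : R) :
  is_derive (fun u => u * cauchy_kernel s u) u
    (2 * s * cauchy_kernel (s + 1) u - (2 * s - 1) * cauchy_kernel s u).
Proof.
assert (H := one_plus_sq_ge u).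
unfold cauchy_kernel, Rpower. auto_derive; [simpl in H; lra|].
replace (- (s + 1) * ln (1 + u ^ 2)) with (- s * ln (1 + u ^ 2) + - ln (1 + u ^ 2)) by ring.
rewrite exp_plus, (exp_Ropp (ln _)), exp_ln by lra.
simpl. field. simpl in H; lra.
Qed.

(** The boundary value [B] is left free: it is 0 for [s >= 1], which gives the recurrence, and 1 for
    [s = 1/2], which gives the value at [3/2]. *)
Lemma half_line_int_cauchy_primitive (s B : R) :
  is_lim (fun u => u * cauchy_kernel s u) p_infty B ->
  half_line_int (fun u => 2 * s * cauchy_kernel (s + 1) u - (2 * s - 1) * cauchy_kernel s u) B.
Proof.
intros HB. rewrite <- (Rminus_0_r B).
apply half_line_int_derive with (fun u => u * cauchy_kernel s u); auto.
- intros; apply is_derive_cauchy_primitive.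
- intros u _. apply (continuous_minus (V := R_NormedModule));
    apply (continuous_scal_r (V := R_NormedModule)); apply cauchy_kernel_continuous.
- replace 0 with (0 * cauchy_kernel s 0) at 2 by ring.
  apply (filterlim_at_right_continuous (fun u => u * cauchy_kernel s u)).
  apply (ex_derive_continuous (V := R_NormedModule)). eexists; apply is_derive_cauchy_primitive.
Qed.

Lemma cauchy_int_succ (s : R) : 1 <= s -> 2 * s * cauchy_int (s + 1) = (2 * s - 1) * cauchy_int s.
Proof.
intros Hs.
assert (D : half_line_int (fun u => 2 * s * cauchy_kernel (s + 1) u - (2 * s - 1) * cauchy_kernel s u) 0).
{ apply half_line_int_cauchy_primitive.
  apply is_lim_le_le_loc with (fun _ => 0) Rinv; [|apply is_lim_const | apply is_lim_inv_p].
  (* The boundary term is at most [u / (1 + u^2) <= 1 / u]. *)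
  exists 0. intros u Hu. assert (H := one_plus_sq_ge u).
  split; [left; apply Rmult_lt_0_compat; [lra | apply cauchy_kernel_pos]|].
  apply Rle_trans with (u * cauchy_kernel 1 u).
  { apply Rmult_le_compat_l; [lra | now apply cauchy_kernel_antitone]. }
  rewrite cauchy_kernel_1. apply Rminus_le_0.
  replace (_ - _) with (/ u * / (1 + u ^ 2)) by (field; split; lra).
  left; apply Rmult_lt_0_compat; apply Rinv_0_lt_compat; lra. }
assert (M := half_line_int_lincomb _ _ (2 * s) (- (2 * s - 1)) _ _
  (proj1 (cauchy_int_correct (s + 1) ltac:(lra))) (proj1 (cauchy_int_correct s Hs))).
apply half_line_int_ext with (g := fun u => 2 * s * cauchy_kernel (s + 1) u - (2 * s - 1) * cauchy_kernel s u) in M;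
  [|intros; ring].
assert (U := half_line_int_unique _ _ _ D M). lra.
Qed.

Lemma cauchy_int_1 : cauchy_int 1 = PI / 2.
Proof.
apply half_line_int_unique with (cauchy_kernel 1); [apply cauchy_int_correct; lra|].
rewrite <- (Rminus_0_r (PI / 2)).
apply half_line_int_derive with atan.
- intros; apply is_derive_atan_kernel.
- intros; apply cauchy_kernel_continuous.
- rewrite <- atan_0 at 2. apply filterlim_at_right_continuous,  (ex_derive_continuous (V := R_NormedModule)).
  eexists; apply is_derive_atan_kernel.
- apply is_lim_ext_loc with (fun u => PI / 2 - atan (/ u)).
  { exists 0. intros u Hu. rewrite atan_inv by assumption. ring. }
  replace (Finite (PI / 2)) with (Finite (PI / 2 - atan 0)) by (rewrite atan_0; f_equal; ring).
  apply is_lim_minus'; [apply is_lim_const|].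
  apply is_lim_comp_continuous; [apply is_lim_inv_p|].
  apply (ex_derive_continuous (V := R_NormedModule)). eexists; apply is_derive_atan_kernel.
Qed.

(** At [s = 1/2] the coefficient [2 s - 1] vanishes, so only the kernel of exponent [3/2] is left,
    with primitive [u / sqrt (1 + u^2)]. *)
Lemma cauchy_int_3_2 : cauchy_int (3 / 2) = 1.
Proof.
apply half_line_int_unique with (cauchy_kernel (3 / 2)); [apply cauchy_int_correct; lra|].
apply half_line_int_ext with (fun u => 2 * / 2 * cauchy_kernel (/ 2 + 1) u - (2 * / 2 - 1) * cauchy_kernel (/ 2) u).
{ intros u _. replace (/ 2 + 1) with (3 / 2) by field. field. }
apply half_line_int_cauchy_primitive.
apply is_lim_le_le_loc with (fun u => 1 - / u) (fun _ => 1).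
- exists 0. intros u Hu.
  split.
  + apply Rle_trans with (u * / (1 + u)).
    * apply Rminus_le_0. replace (_ - _) with (/ u * / (1 + u)) by (field; lra).
      left; apply Rmult_lt_0_compat; apply Rinv_0_lt_compat; lra.
    * apply Rmult_le_compat_l; [lra|]. rewrite <- (Rpower_sq_opp_half (1 + u)) by lra. unfold cauchy_kernel.
      assert (H := one_plus_sq_ge u).
      apply Rpower_opp_le; [lra|]. split; [lra|]. replace ((1 + u) ^ 2) with (1 + u ^ 2 + 2 * u) by ring. lra.
  + apply Rle_trans with (u * / u); [|right; field; lra].
    apply Rmult_le_compat_l; [lra|]. rewrite <- (Rpower_sq_opp_half u) by lra. unfold cauchy_kernel.
    apply Rpower_opp_le; [lra|]. split; [now apply pow_lt | lra].
- replace (Finite 1) with (Finite (1 - 0)) by (f_equal; ring).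
  apply is_lim_minus'; [apply is_lim_const | apply is_lim_inv_p].
- apply is_lim_const.
Qed.

Lemma cauchy_int_2 : cauchy_int 2 = PI / 4.
Proof.
assert (H := cauchy_int_succ 1 ltac:(lra)). rewrite cauchy_int_1 in H.
replace (1 + 1) with 2 in H by ring. lra.
Qed.

(** A Wallis-type invariant: the recurrence makes this product unchanged under [s -> s + 1/2], and
    the values at 1 and [3/2] give [1/2 * (PI/2) * 1] at the start. *)
Lemma cauchy_int_half_integers (m : nat) :
  let s := 1 + INR m / 2 in (s - / 2) * (cauchy_int s * cauchy_int (s + / 2)) = PI / 4.
Proof.
induction m as [|m IH]; simpl in *.
- replace (1 + 0 / 2 + / 2) with (3 / 2) by field. replace (1 + 0 / 2) with 1 by field.
  rewrite cauchy_int_1, cauchy_int_3_2. field.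
- change (match m with O => 1 | S _ => INR m + 1 end) with (INR (S m)). rewrite S_INR.
  set (s := 1 + INR m / 2) in *. assert (0 <= INR m) by apply pos_INR.
  assert (Hs : 1 <= s) by (unfold s; lra).
  replace (1 + (INR m + 1) / 2) with (s + / 2) by (unfold s; field).
  replace (s + / 2 + / 2) with (s + 1) by field.
  assert (R1 := cauchy_int_succ s Hs). rewrite <- IH.
  replace (s + / 2 - / 2) with s by ring.
  replace (s * (cauchy_int (s + / 2) * cauchy_int (s + 1)))
    with (cauchy_int (s + / 2) * (2 * s * cauchy_int (s + 1)) / 2) by field.
  rewrite R1. field.
Qed.

(** With [t] the half-integer just below [x], monotonicity puts [cauchy_int x ^ 2] between products
    at consecutive half-integers, known exactly: those at [t + 1/2, t + 1] below and at [t - 1/2, t]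
    above. *)
Lemma cauchy_int_sq_bounds (x : R) : 2 <= x ->
  PI / 4 / x <= cauchy_int x ^ 2 <= PI / 4 / (x - 3 / 2).
Proof.
intros Hx.
destruct (nfloor_ex (2 * (x - 1)) ltac:(lra)) as [m Hm].
(* [x >= 2] excludes floor 0; passing to the predecessor makes [t - 1/2] an admissible half-integer
   as well. *)
destruct m as [|m]; [simpl in Hm; lra|].
assert (HA := cauchy_int_half_integers m). assert (HB := cauchy_int_half_integers (S (S m))).
cbv zeta in HA, HB. rewrite S_INR in Hm. rewrite !S_INR in HB.
set (t := 1 + (INR m + 1) / 2) in *.
replace (1 + INR m / 2) with (t - / 2) in HA by (unfold t; field).
replace (1 + (INR m + 1 + 1) / 2) with (t + / 2) in HB by (unfold t; field).
replace (t - / 2 + / 2) with t in HA by ring.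
replace (t + / 2 - / 2) with t in HB by ring.
assert (Ht : t <= x < t + / 2) by (unfold t; lra).
assert (0 <= INR m) by apply pos_INR.
assert (Ht1 : 3 / 2 <= t) by (unfold t; lra).
assert (PIp := PI_RGT_0).
assert (B0 := cauchy_int_pos (t + / 2 + / 2) ltac:(lra)).
assert (B1 := cauchy_int_antitone t x ltac:(lra)).
assert (B2 := cauchy_int_antitone (t - / 2) t ltac:(lra)).
assert (B3 := cauchy_int_antitone x (t + / 2) ltac:(lra)).
assert (B4 := cauchy_int_antitone (t + / 2) (t + / 2 + / 2) ltac:(lra)).
split.
- apply Rle_trans with (PI / 4 / t).
  + apply Rmult_le_compat_l; [lra|]. apply Rinv_le_contravar; lra.
  + rewrite <- HB. replace (_ / t) with (cauchy_int (t + / 2) * cauchy_int (t + / 2 + / 2)) by (field; lra).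
    replace (cauchy_int x ^ 2) with (cauchy_int x * cauchy_int x) by ring. apply Rmult_le_compat; lra.
- apply Rle_trans with (PI / 4 / (t - / 2 - / 2)).
  + rewrite <- HA. replace (_ / (t - / 2 - / 2)) with (cauchy_int (t - / 2) * cauchy_int t) by (field; lra).
    replace (cauchy_int x ^ 2) with (cauchy_int x * cauchy_int x) by ring. apply Rmult_le_compat; lra.
  + apply Rmult_le_compat_l; [lra|]. apply Rinv_le_contravar; lra.
Qed.

(** Midpoint convexity at [x] gives the upper bound and at [x - 1/2] the lower one, each after one
    use of the functional equation. *)
Lemma Gamma_ratio_sq_bounds (x : R) : 1 < x ->
  x - 1 <= (Gamma x / Gamma (x - / 2)) ^ 2 <= x - / 2.
Proof.
intros Hx.
destruct (Gamma_correct x ltac:(lra)) as [_ P0].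
destruct (Gamma_correct (x - / 2) ltac:(lra)) as [_ P1].
destruct (Gamma_correct (x - 1) ltac:(lra)) as [_ P2].
assert (M1 := Gamma_midpoint x ltac:(lra)).
assert (M2 := Gamma_midpoint (x - / 2) ltac:(lra)).
replace (x + / 2) with (x - / 2 + 1) in M1 by field. rewrite Gamma_succ in M1 by lra.
replace (x - / 2 - / 2) with (x - 1) in M2 by field.
replace (x - / 2 + / 2) with x in M2 by field.
assert (S : Gamma x = (x - 1) * Gamma (x - 1)).
{ rewrite <- Gamma_succ by lra. f_equal; ring. }
assert (Q : 0 < Gamma (x - / 2) ^ 2) by now apply pow_lt.
unfold Rdiv; rewrite Rpow_mult_distr, pow_inv.
split.
- apply (Rmult_le_reg_r (Gamma (x - / 2) ^ 2)); [assumption|].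
  rewrite Rmult_assoc, Rinv_l, Rmult_1_r by lra.
  apply (Rmult_le_compat_l (x - 1)) in M2; [|lra].
  replace (Gamma x ^ 2) with ((x - 1) * (Gamma (x - 1) * Gamma x)) by (rewrite S at 1; rewrite S; ring).
  exact M2.
- apply (Rmult_le_reg_r (Gamma (x - / 2) ^ 2)); [assumption|].
  rewrite Rmult_assoc, Rinv_l, Rmult_1_r by lra.
  replace ((x - / 2) * Gamma (x - / 2) ^ 2) with (Gamma (x - / 2) * ((x - / 2) * Gamma (x - / 2))) by ring.
  exact M1.
Qed.

Lemma cauchy_int_Gamma (s : R) : 1 <= s -> cauchy_int s = sqrt PI / 2 * (Gamma (s - / 2) / Gamma s).
Proof.
intros Hs.
(* The two recurrences cancel in [r], so it is constant along [s + n], while [r^2] tends to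
   [PI / 4]. *)
set (r := fun x => cauchy_int x * (Gamma x / Gamma (x - / 2))).
assert (Hper : forall n, r (s + INR n) = r s).
{ induction n as [|n IH]; [simpl; f_equal; ring|].
  rewrite <- IH, S_INR. assert (Hn := pos_INR n).
  set (x := s + INR n) in *. assert (Hx : 1 <= x) by (unfold x; lra).
  replace (s + (INR n + 1)) with (x + 1) by (unfold x; ring). unfold r.
  destruct (Gamma_correct (x - / 2) ltac:(lra)) as [_ P1].
  destruct (Gamma_correct x ltac:(lra)) as [_ P2].
  rewrite Gamma_succ by lra.
  replace (x + 1 - / 2) with (x - / 2 + 1) by ring. rewrite Gamma_succ by lra.
  replace (cauchy_int (x + 1)) with ((2 * x - 1) * cauchy_int x / (2 * x))
    by (rewrite <- cauchy_int_succ by lra; field; lra).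
  field. repeat split; lra. }
assert (PIp := PI_RGT_0).
(* Multiplying the two sandwiches leaves [r x ^ 2] within [(PI/4) / (x - 3/2)] of [PI / 4]. *)
assert (Hb : forall x, 2 <= x -> Rabs (r x ^ 2 - PI / 4) * (x - 3 / 2) <= PI / 4).
{ intros x Hx. unfold r. rewrite Rpow_mult_distr.
  destruct (cauchy_int_sq_bounds x Hx) as [C1 C2].
  destruct (Gamma_ratio_sq_bounds x ltac:(lra)) as [G1 G2].
  set (c := cauchy_int x ^ 2) in *. set (g := (Gamma x / Gamma (x - / 2)) ^ 2) in *.
  assert (C0 : 0 < PI / 4 / x) by (apply Rdiv_lt_0_compat; lra).
  assert (L : PI / 4 / x * (x - 1) <= c * g) by (apply Rmult_le_compat; lra).
  assert (U : c * g <= PI / 4 / (x - 3 / 2) * (x - / 2)) by (apply Rmult_le_compat; lra).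
  replace (PI / 4 / x * (x - 1)) with (PI / 4 - PI / 4 / x) in L by (field; lra).
  replace (PI / 4 / (x - 3 / 2) * (x - / 2)) with (PI / 4 + PI / 4 / (x - 3 / 2)) in U by (field; lra).
  assert (V : PI / 4 / x <= PI / 4 / (x - 3 / 2)).
  { apply Rmult_le_compat_l; [lra|]. apply Rinv_le_contravar; lra. }
  apply Rle_trans with (PI / 4 / (x - 3 / 2) * (x - 3 / 2)); [|right; field; lra].
  apply Rmult_le_compat_r; [lra|]. apply Rabs_le; lra. }
destruct (Gamma_correct (s - / 2) ltac:(lra)) as [_ P1].
destruct (Gamma_correct s ltac:(lra)) as [_ P2].
assert (P3 := cauchy_int_pos s Hs).
assert (Hr : 0 < r s) by (apply Rmult_lt_0_compat; [lra | now apply Rdiv_lt_0_compat]).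
assert (E : r s ^ 2 = PI / 4).
{ apply Rminus_diag_uniq. destruct (Req_dec (r s ^ 2 - PI / 4) 0) as [E|E]; [exact E|exfalso].
  apply Rabs_pos_lt in E. set (d := Rabs (r s ^ 2 - PI / 4)) in *.
  (* [n] is so large that a constant defect [d] violates [Hb] at [s + n + 1]. *)
  destruct (nfloor_ex (PI / 4 / d + 1)) as [n Hn].
  { assert (0 < PI / 4 / d) by (apply Rdiv_lt_0_compat; lra). lra. }
  assert (B := Hb (s + INR (S n))). rewrite Hper in B. fold d in B. rewrite S_INR in B.
  assert (0 < PI / 4 / d) by (apply Rdiv_lt_0_compat; lra).
  specialize (B ltac:(lra)).
  assert (d * (PI / 4 / d) < d * (s + (INR n + 1) - 3 / 2)) by (apply Rmult_lt_compat_l; lra).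
  replace (d * (PI / 4 / d)) with (PI / 4) in H0 by (field; lra). lra. }
assert (E2 : r s = sqrt PI / 2).
{ rewrite <- (sqrt_pow2 (r s)) by lra. rewrite E. rewrite sqrt_div by lra.
  replace 4 with (2 ^ 2) by ring. now rewrite sqrt_pow2 by lra. }
rewrite <- E2. unfold r. field. split; lra.
Qed.

(** * Lattice sums *)

Lemma ex_series_inv_sq : ex_series (fun k => / (INR k + 1) ^ 2).
Proof.
(* A telescoping majorant, valid because [k + 2 <= 2 (k + 1)]. *)
apply (ex_series_le (V := R_CompleteNormedModule)) with (fun k => 2 * (/ (INR k + 1) - / (INR k + 2))).
- intros k. assert (H := pos_INR k). change (Rabs (/ (INR k + 1) ^ 2) <= 2 * (/ (INR k + 1) - / (INR k + 2))).
  rewrite Rabs_pos_eq by (left; apply Rinv_0_lt_compat, pow_lt; lra).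
  apply Rminus_le_0.
  replace (_ - _) with (INR k * (/ (INR k + 1) ^ 2 * / (INR k + 2))) by (field; lra).
  apply Rmult_le_pos; [lra|]. left; apply Rmult_lt_0_compat; apply Rinv_0_lt_compat; [apply pow_lt|]; lra.
- apply (ex_series_scal (V := R_NormedModule)).
  exists 1. change (is_lim_seq (sum_n (fun k => / (INR k + 1) - / (INR k + 2))) 1).
  apply is_lim_seq_ext with (fun n => 1 - / (INR n + 2)).
  + induction n as [|n IH]; [rewrite sum_O; simpl; field|].
    rewrite sum_Sn, <- IH, S_INR. assert (H := pos_INR n). unfold plus; simpl. field; lra.
  + replace (Finite 1) with (Finite (1 - 0)) by (f_equal; ring).
    apply is_lim_seq_minus'; [apply is_lim_seq_const|].
    apply (is_lim_seq_inv _ p_infty); [|easy].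
    apply (is_lim_seq_plus _ _ p_infty 2); [apply is_lim_seq_INR | apply is_lim_seq_const | easy].
Qed.

Lemma ex_series_le_pos (a b : nat -> R) : (forall k, 0 <= a k <= b k) -> ex_series b -> ex_series a.
Proof.
intros H. apply (ex_series_le (V := R_CompleteNormedModule)). intros k.
change (Rabs (a k) <= b k). rewrite Rabs_pos_eq; apply H.
Qed.

Lemma Series_nonneg (a : nat -> R) : (forall k, 0 <= a k) -> ex_series a -> 0 <= Series a.
Proof.
intros H E. replace 0 with (Series (fun k => 0 * a k)) by (rewrite Series_scal_l; ring).
apply Series_le; [|assumption]. intros k; rewrite Rmult_0_l. split; [lra | apply H].
Qed.

Lemma Series_ge_first (a : nat -> R) : (forall k, 0 <= a k) -> ex_series a -> a O <= Series a.
Proof.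
intros H E. rewrite Series_incr_1 by assumption.
assert (0 <= Series (fun k => a (S k))) by (apply Series_nonneg; [auto | exact (proj1 (ex_series_incr_1 (V := R_NormedModule) a) E)]).
lra.
Qed.

(* Two-sided sums over [l + 2 k PI] are [Phi s x l + Phi s x (2 PI - l)]. *)
Definition Phi (s x l : R) : R := Series (fun k => Rpower (x + (l + 2 * INR k * PI) ^ 2) (- s)).

Lemma one_plus_sq_le (x w : R) : 0 < x -> 1 + w ^ 2 <= (1 + / x) * (x + w ^ 2).
Proof.
intros Hx.
replace ((1 + / x) * (x + w ^ 2)) with (1 + w ^ 2 + (x + w ^ 2 * / x)) by (field; lra).
assert (0 <= w ^ 2 * / x) by (apply Rmult_le_pos; [apply pow2_ge_0 | left; now apply Rinv_0_lt_compat]). lra.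
Qed.

(** The relative change under a shift by [e] is [O(|e|)] uniformly in [w], so it can be summed over
    all lattice points at once. *)
Lemma shift_ratio_le (x w e : R) : 0 < x -> Rabs e <= 1 ->
  x + (w + e) ^ 2 <= (1 + 2 * (1 + / x) * Rabs e) * (x + w ^ 2).
Proof.
intros Hx He.
assert (H0 := Rabs_pos e). assert (H1 := Rle_abs (w * e)).
assert (Hw := Rabs_pos w).
rewrite Rabs_mult in H1.
assert (H2 : 2 * Rabs w <= 1 + w ^ 2).
{ rewrite <- (pow2_abs w). assert (H := pow2_ge_0 (1 - Rabs w)). lra. }
assert (H3 : e ^ 2 <= Rabs e).
{ rewrite <- (pow2_abs e). assert (0 <= Rabs e * (1 - Rabs e)) by (apply Rmult_le_pos; lra). lra. }
assert (H4 := one_plus_sq_le x w Hx).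
assert (H5 := pow2_ge_0 w).
assert (H6 : Rabs e * (2 * Rabs w) <= Rabs e * (1 + w ^ 2)) by now apply Rmult_le_compat_l.
assert (H7 : Rabs e * (1 + w ^ 2) <= Rabs e * ((1 + / x) * (x + w ^ 2))) by now apply Rmult_le_compat_l.
assert (H8 : 0 <= Rabs e * w ^ 2) by now apply Rmult_le_pos.
apply Rle_trans with (x + w ^ 2 + 2 * (Rabs w * Rabs e) + Rabs e); [|lra].
replace ((w + e) ^ 2) with (w ^ 2 + 2 * (w * e) + e ^ 2) by ring. lra.
Qed.

Lemma base_pos (x w : R) : 0 < x -> 0 < x + w ^ 2.
Proof. intros Hx. assert (H := pow2_ge_0 w). lra. Qed.

Lemma ex_series_Phi (s x l : R) : 1 <= s -> 0 < x ->
  ex_series (fun k => Rpower (x + (l + 2 * INR k * PI) ^ 2) (- s)).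
Proof.
intros Hs Hx.
(* [c] absorbs the shift [l]: [(k+1)^2 <= c (x + (l + 2 k PI)^2)]. *)
set (c := 4 * (1 + / x) * (1 + l ^ 2)).
assert (Hix : 0 < / x) by now apply Rinv_0_lt_compat.
assert (Hl := pow2_ge_0 l).
assert (Hc : 0 < c) by (unfold c; apply Rmult_lt_0_compat; lra).
apply ex_series_le_pos with (fun k => Rpower (/ c) (- s) * / (INR k + 1) ^ 2);
  [|apply (ex_series_scal (V := R_NormedModule)), ex_series_inv_sq].
intros k. split; [left; apply Rpower_pos|].
assert (Hk := pos_INR k).
assert (Hk2 : 1 <= (INR k + 1) ^ 2) by (apply pow_R1_Rle; lra).
apply Rle_trans with (Rpower (/ c * (INR k + 1) ^ 2) (- s)).
- apply Rpower_opp_le; [lra|]. split; [apply Rmult_lt_0_compat; [now apply Rinv_0_lt_compat | lra]|].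
  apply (Rmult_le_reg_l c); [assumption|].
  rewrite <- Rmult_assoc, Rinv_r, Rmult_1_l by lra.
  set (w := l + 2 * INR k * PI).
  (* [w - l = 2 k PI >= k]; then [A2] trades [w - l] for [w] by
     [1 + (w - l)^2 <= 2 (1 + l^2) (1 + w^2)]. *)
  assert (A1 : (INR k + 1) ^ 2 <= 2 * (1 + (w - l) ^ 2)).
  { assert (INR k ^ 2 <= (w - l) ^ 2).
    { apply pow_incr. split; [assumption|]. unfold w. assert (P := PI2_1).
      assert (INR k * 1 <= INR k * (2 * PI)) by (apply Rmult_le_compat_l; lra). lra. }
    assert (H1 := pow2_ge_0 (INR k - 1)). lra. }
  assert (A2 : 1 + (w - l) ^ 2 <= 2 * ((1 + / x) * (1 + l ^ 2) * (x + w ^ 2))).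
  { assert (H4 := one_plus_sq_le x w Hx).
    apply (Rmult_le_compat_l (1 + l ^ 2)) in H4; [|lra].
    assert (H5 := pow2_ge_0 (l + w)). assert (H6 := pow2_ge_0 (l * w)). lra. }
  unfold c. lra.
- rewrite <- Rpower_mult_distr by (try apply Rinv_0_lt_compat; lra).
  apply Rmult_le_compat_l; [left; apply Rpower_pos|].
  rewrite <- Rpower_opp_1 by lra. unfold Rpower. apply exp_le.
  assert (0 <= ln ((INR k + 1) ^ 2)) by (rewrite <- ln_1; apply ln_le; lra).
  assert (0 <= (s - 1) * ln ((INR k + 1) ^ 2)) by (apply Rmult_le_pos; lra). lra.
Qed.

Lemma Phi_ge_first (s x l : R) : 1 <= s -> 0 < x -> Rpower (x + l ^ 2) (- s) <= Phi s x l.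
Proof.
intros Hs Hx. replace l with (l + 2 * INR 0 * PI) at 1 by (simpl; ring).
apply (Series_ge_first (fun k => Rpower (x + (l + 2 * INR k * PI) ^ 2) (- s))).
- intros k; left; apply Rpower_pos.
- now apply ex_series_Phi.
Qed.

Lemma Phi_pos (s x l : R) : 1 <= s -> 0 < x -> 0 < Phi s x l.
Proof. intros Hs Hx. apply Rlt_le_trans with (2 := Phi_ge_first s x l Hs Hx). apply Rpower_pos. Qed.

(** Termwise, a shift by [e] costs at most a factor [q e] that tends to 1; applied in both
    directions, this is a relative modulus of continuity. *)
Lemma Phi_continuous (s x l : R) : 1 <= s -> 0 < x -> continuous (Phi s x) l.
Proof.
intros Hs Hx.
assert (Hs0 : 0 <= s) by lra.
set (q := fun e => Rpower (1 + 2 * (1 + / x) * e) s).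
assert (Hix : 0 < / x) by now apply Rinv_0_lt_compat.
assert (Hle : forall a b, Rabs (b - a) <= 1 -> Phi s x a <= q (Rabs (b - a)) * Phi s x b).
{ intros a b Hab. unfold Phi. rewrite <- Series_scal_l. apply Series_le.
  2: { apply (ex_series_scal (V := R_NormedModule)). now apply ex_series_Phi. }
  intros k. split; [left; apply Rpower_pos|].
  assert (Hp : 0 < 1 + 2 * (1 + / x) * Rabs (b - a)).
  { assert (0 <= (1 + / x) * Rabs (b - a)) by (apply Rmult_le_pos; [lra | apply Rabs_pos]). lra. }
  assert (R := shift_ratio_le x (a + 2 * INR k * PI) (b - a) Hx Hab).
  replace (a + 2 * INR k * PI + (b - a)) with (b + 2 * INR k * PI) in R by ring.
  apply (conj (base_pos x (b + 2 * INR k * PI) Hx)), (Rpower_opp_le _ _ s Hs0) in R.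
  rewrite <- Rpower_mult_distr in R by (try apply base_pos; lra).
  rewrite (Rpower_Ropp (1 + _)) in R. fold (q (Rabs (b - a))) in R.
  assert (Hq : 0 < q (Rabs (b - a))) by apply Rpower_pos.
  apply (Rmult_le_compat_l (q (Rabs (b - a)))) in R; [|lra].
  rewrite <- Rmult_assoc, Rinv_r, Rmult_1_l in R by lra. exact R. }
assert (P0 := Phi_pos s x l Hs Hx).
assert (Hq : continuous q 0).
{ apply (ex_derive_continuous (V := R_NormedModule)). unfold q, Rpower. auto_derive. lra. }
assert (Q0 : q 0 = 1) by (unfold q, Rpower; rewrite Rmult_0_r, Rplus_0_r, ln_1, Rmult_0_r; apply exp_0).
intros P [eps HP].
assert (He : 0 < eps / (Phi s x l + 1)) by (apply Rdiv_lt_0_compat; [apply cond_pos | lra]).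
destruct (Hq (ball (q 0) (mkposreal _ He)) (locally_ball _ _)) as [d Hd].
assert (Hm : 0 < Rmin d 1) by (apply Rmin_glb_lt; [apply cond_pos | lra]).
exists (mkposreal _ Hm). intros l' Hl'. change (Rabs (l' - l) < Rmin d 1) in Hl'.
assert (M1 := Rmin_l d 1). assert (M2 := Rmin_r d 1).
apply HP. change (Rabs (Phi s x l' - Phi s x l) < eps).
assert (Hqe : Rabs (q (Rabs (l' - l)) - q 0) < eps / (Phi s x l + 1)).
{ apply Hd. change (Rabs (Rabs (l' - l) - 0) < d). rewrite Rminus_0_r, Rabs_Rabsolu. lra. }
rewrite Q0 in Hqe. apply Rabs_def2 in Hqe.
assert (L1 := Hle l l' ltac:(lra)). assert (L2 := Hle l' l ltac:(rewrite Rabs_minus_sym; lra)).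
rewrite Rabs_minus_sym in L2. set (u := q (Rabs (l' - l))) in *.
assert (Hu : 1 <= u).
{ assert (0 <= (1 + / x) * Rabs (l' - l)) by (apply Rmult_le_pos; [lra | apply Rabs_pos]).
  rewrite <- Q0. unfold u, q. rewrite Rmult_0_r. apply Rle_Rpower_l; lra. }
assert (E : (u - 1) * Phi s x l < eps).
{ apply Rle_lt_trans with ((u - 1) * (Phi s x l + 1)); [apply Rmult_le_compat_l; lra|].
  apply Rlt_le_trans with (eps / (Phi s x l + 1) * (Phi s x l + 1)); [apply Rmult_lt_compat_r; lra|].
  right; field; lra. }
assert (P1 := Phi_pos s x l' Hs Hx).
apply Rabs_def1; [lra|].
(* The drop is at most [(u - 1) * Phi s x l'], which [E] controls when [Phi s x l' <= Phi s x l];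
   otherwise there is no drop. *)
destruct (Rle_lt_dec (Phi s x l') (Phi s x l)) as [C|C]; [|lra].
assert ((u - 1) * Phi s x l' <= (u - 1) * Phi s x l) by (apply Rmult_le_compat_l; lra).
lra.
Qed.

(** Convexity of [y^(-s)] as a tangent inequality, from [exp v >= 1 + v] and
    [ln z - ln y <= (z - y) / y]. *)
Lemma Rpower_opp_tangent (s y z : R) : 0 <= s -> 0 < y -> 0 < z ->
  Rpower y (- s) - s * Rpower y (- (s + 1)) * (z - y) <= Rpower z (- s).
Proof.
intros Hs Hy Hz.
assert (L := ln_le_tangent y z Hy Hz).
assert (L2 : ln z - ln y <= / y * (z - y)).
{ apply (Rmult_le_reg_l y); [lra|]. rewrite <- Rmult_assoc, Rinv_r by lra. lra. }
assert (E := exp_ineq1_le (- s * (ln z - ln y))).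
assert (S1 : s * (ln z - ln y) <= s * (/ y * (z - y))) by now apply Rmult_le_compat_l.
replace (- (s + 1)) with (- s + - (1)) by ring. rewrite Rpower_plus, Rpower_opp_1 by lra.
replace (Rpower z (- s)) with (Rpower y (- s) * exp (- s * (ln z - ln y))).
2: { unfold Rpower. rewrite <- exp_plus. f_equal; ring. }
replace (_ - _) with (Rpower y (- s) * (1 - s * (/ y * (z - y)))) by ring.
apply Rmult_le_compat_l; [left; apply Rpower_pos | lra].
Qed.

(** The increment of the base is [z - x] in every term, so the tangent inequalities add up to one
    for [Phi]. *)
Lemma Phi_tangent (s x z l : R) : 1 <= s -> 0 < x -> 0 < z ->
  Phi s x l - s * (z - x) * Phi (s + 1) x l <= Phi s z l.
Proof.
intros Hs Hx Hz. unfold Phi.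
rewrite <- Series_scal_l. rewrite <- Series_minus; [| now apply ex_series_Phi |
  apply (ex_series_scal (V := R_NormedModule)), ex_series_Phi; lra].
apply Rminus_le_0. rewrite <- Series_minus; [| now apply ex_series_Phi |
  apply (ex_series_minus (V := R_NormedModule)); [now apply ex_series_Phi |
  apply (ex_series_scal (V := R_NormedModule)), ex_series_Phi; lra]].
apply Series_nonneg.
- intros k.
  assert (T := Rpower_opp_tangent s _ _ ltac:(lra) (base_pos x (l + 2 * INR k * PI) Hx) (base_pos z (l + 2 * INR k * PI) Hz)).
  replace (z + (l + 2 * INR k * PI) ^ 2 - (x + (l + 2 * INR k * PI) ^ 2)) with (z - x) in T by ring.
  lra.
- apply (ex_series_minus (V := R_NormedModule)); [now apply ex_series_Phi|].
  apply (ex_series_minus (V := R_NormedModule)); [now apply ex_series_Phi|].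
  apply (ex_series_scal (V := R_NormedModule)), ex_series_Phi; lra.
Qed.

Lemma Phi_antitone (s x z l : R) : 1 <= s -> 0 < x <= z -> Phi s z l <= Phi s x l.
Proof.
intros Hs Hx. apply Series_le; [|apply ex_series_Phi; lra].
intros k. split; [left; apply Rpower_pos|].
apply Rpower_opp_le; [lra|]. split; [apply base_pos; lra | lra].
Qed.

(* Convexity of [y^(-s)] squeezes the difference quotient between the values of [- s Phi (s+1)] at [x] and [x + h]. *)
Lemma is_derive_Phi (s x l : R) : 1 <= s -> 0 < x ->
  is_derive (fun x => Phi s x l) x (- s * Phi (s + 1) x l).
Proof.
intros Hs Hx. apply is_derive_Reals.
(* A Lipschitz constant of [s * Phi (s + 1)] on [[x / 2, infinity)], by the tangent inequality at
   exponent [s + 1]. Keeping [|h| < x / 2] keeps [x + h] in that range. *)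
set (D := s * (s + 1) * Phi (s + 2) (x / 2) l).
assert (HD : 0 < D).
{ repeat apply Rmult_lt_0_compat; try lra. apply Phi_pos; lra. }
intros eps Heps.
assert (Hd : 0 < Rmin (x / 2) (eps / D)) by (apply Rmin_glb_lt; [lra | now apply Rdiv_lt_0_compat]).
exists (mkposreal _ Hd). intros h Hh0 Hh. simpl in Hh.
assert (M1 := Rmin_l (x / 2) (eps / D)). assert (M2 := Rmin_r (x / 2) (eps / D)).
assert (Hh1 : - (x / 2) < h < x / 2) by (split; apply Rabs_def2; lra).
assert (Hh2 : Rabs h * D < eps).
{ apply Rlt_le_trans with (eps / D * D); [apply Rmult_lt_compat_r; lra | right; field; lra]. }
assert (T1 := Phi_tangent s x (x + h) l Hs Hx ltac:(lra)).
assert (T2 := Phi_tangent s (x + h) x l Hs ltac:(lra) Hx).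
replace (x + h - x) with h in T1 by ring. replace (x - (x + h)) with (- h) in T2 by ring.
assert (T3 := Phi_tangent (s + 1) x (x + h) l ltac:(lra) Hx ltac:(lra)).
assert (T4 := Phi_tangent (s + 1) (x + h) x l ltac:(lra) ltac:(lra) Hx).
replace (x + h - x) with h in T3 by ring. replace (x - (x + h)) with (- h) in T4 by ring.
replace (s + 1 + 1) with (s + 2) in T3, T4 by ring.
assert (A1 := Phi_antitone (s + 2) (x / 2) x l ltac:(lra) ltac:(lra)).
assert (A2 := Phi_antitone (s + 2) (x / 2) (x + h) l ltac:(lra) ltac:(lra)).
assert (Q1 := Phi_pos (s + 2) x l ltac:(lra) Hx).
assert (Q2 := Phi_pos (s + 2) (x + h) l ltac:(lra) ltac:(lra)).
set (F := Phi (s + 2) (x / 2) l) in *. set (G := Phi (s + 1) (x + h) l) in *.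
set (G0 := Phi (s + 1) x l) in *.
assert (L : Rabs (G - G0) <= (s + 1) * (Rabs h * F)).
{ assert (B1 : Rabs h * Phi (s + 2) x l <= Rabs h * F) by (apply Rmult_le_compat_l; [apply Rabs_pos | lra]).
  assert (B2 : Rabs h * Phi (s + 2) (x + h) l <= Rabs h * F) by (apply Rmult_le_compat_l; [apply Rabs_pos | lra]).
  assert (B3 : h * Phi (s + 2) x l <= Rabs h * Phi (s + 2) x l) by (apply Rmult_le_compat_r; [lra | apply Rle_abs]).
  assert (B4 : - h * Phi (s + 2) (x + h) l <= Rabs h * Phi (s + 2) (x + h) l).
  { apply Rmult_le_compat_r; [lra | rewrite <- Rabs_Ropp; apply Rle_abs]. }
  assert (C1 : (s + 1) * (h * Phi (s + 2) x l) <= (s + 1) * (Rabs h * F)) by (apply Rmult_le_compat_l; lra).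
  assert (C2 : (s + 1) * (- h * Phi (s + 2) (x + h) l) <= (s + 1) * (Rabs h * F)) by (apply Rmult_le_compat_l; lra).
  apply Rabs_le. lra. }
assert (E : Rabs (Phi s (x + h) l - Phi s x l + s * h * G0) <= Rabs h * (s * Rabs (G - G0))).
{ rewrite Rabs_pos_eq by lra.
  apply Rle_trans with (s * (h * (G0 - G))); [lra|].
  apply Rle_trans with (s * (Rabs h * Rabs (G - G0))); [|right; ring].
  apply Rmult_le_compat_l; [lra|]. rewrite (Rabs_minus_sym G), <- Rabs_mult. apply Rle_abs. }
apply (Rmult_lt_reg_l (Rabs h)); [now apply Rabs_pos_lt|].
rewrite <- Rabs_mult.
replace (h * ((Phi s (x + h) l - Phi s x l) / h - - s * G0)) with (Phi s (x + h) l - Phi s x l + s * h * G0) by (field; assumption).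
apply Rle_lt_trans with (1 := E).
apply Rmult_lt_compat_l; [now apply Rabs_pos_lt|].
apply Rle_lt_trans with (s * ((s + 1) * (Rabs h * F))); [apply Rmult_le_compat_l; lra|].
apply Rle_lt_trans with (2 := Hh2). right; unfold D; ring.
Qed.

Definition lattice_sum (s x l : R) : R := Phi s x l + Phi s x (2 * PI - l).

Lemma lattice_sum_continuous (s x l : R) : 1 <= s -> 0 < x -> continuous (lattice_sum s x) l.
Proof.
intros Hs Hx. apply (continuous_plus (V := R_NormedModule)); [now apply Phi_continuous|].
apply (continuous_comp (fun l => 2 * PI - l) (Phi s x)); [|now apply Phi_continuous].
apply (ex_derive_continuous (V := R_NormedModule)). auto_derive. exact I.
Qed.

Lemma is_derive_lattice_sum (s x l : R) : 1 <= s -> 0 < x ->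
  is_derive (fun x => lattice_sum s x l) x (- s * lattice_sum (s + 1) x l).
Proof.
intros Hs Hx. unfold lattice_sum. rewrite Rmult_plus_distr_l.
apply (is_derive_plus (V := R_NormedModule)); now apply is_derive_Phi.
Qed.

Lemma lattice_sum_ge (s x l : R) : 1 <= s -> 0 < x -> Rpower (x + l ^ 2) (- s) <= lattice_sum s x l.
Proof.
intros Hs Hx. unfold lattice_sum.
assert (H1 := Phi_ge_first s x l Hs Hx). assert (H2 := Phi_pos s x (2 * PI - l) Hs Hx). lra.
Qed.

Lemma lattice_sum_pos (s x l : R) : 1 <= s -> 0 < x -> 0 < lattice_sum s x l.
Proof. intros Hs Hx. apply Rlt_le_trans with (2 := lattice_sum_ge s x l Hs Hx). apply Rpower_pos. Qed.

(** This is zeta(2); it bounds each one-sided sum over the lattice points away from the origin. *)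
Definition inv_sq_sum : R := Series (fun k => / (INR k + 1) ^ 2).

Lemma far_term_le (s x w k : R) : 1 <= s -> 0 < x -> 0 <= k -> k + 1 <= w ->
  Rpower (x + w ^ 2) (- s) <= / (k + 1) ^ 2.
Proof.
intros Hs Hx Hk Hw.
assert (H1 : 1 <= (k + 1) ^ 2) by (apply pow_R1_Rle; lra).
assert (H2 : (k + 1) ^ 2 <= w ^ 2) by (apply pow_incr; lra).
apply Rle_trans with (Rpower ((k + 1) ^ 2) (- s)); [apply Rpower_opp_le; lra|].
rewrite <- Rpower_opp_1 by lra. apply exp_le.
assert (0 <= ln ((k + 1) ^ 2)) by (rewrite <- ln_1; apply ln_le; lra).
assert (0 <= (s - 1) * ln ((k + 1) ^ 2)) by (apply Rmult_le_pos; lra). lra.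
Qed.

(** For [|l| <= PI] every lattice point except [l] itself is at distance at least
    [(2 k + 1) PI >= k + 1] from 0, with [k] counting along each side. *)
Lemma lattice_sum_le (s x l : R) : 1 <= s -> 0 < x -> - PI <= l <= PI ->
  lattice_sum s x l <= Rpower (x + l ^ 2) (- s) + 2 * inv_sq_sum.
Proof.
intros Hs Hx Hl. assert (P := PI2_1).
assert (A : Phi s x l <= Rpower (x + l ^ 2) (- s) + inv_sq_sum).
{ unfold Phi. rewrite Series_incr_1 by now apply ex_series_Phi.
  apply Rplus_le_compat.
  - right; f_equal; simpl; ring.
  - apply Series_le; [|apply ex_series_inv_sq]. intros k. split; [left; apply Rpower_pos|].
    assert (Hk := pos_INR k). apply far_term_le; try assumption. rewrite S_INR.
    assert (INR k * 1 <= INR k * (2 * PI)) by (apply Rmult_le_compat_l; lra). lra. }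
assert (B : Phi s x (2 * PI - l) <= inv_sq_sum).
{ apply Series_le; [|apply ex_series_inv_sq]. intros k. split; [left; apply Rpower_pos|].
  assert (Hk := pos_INR k). apply far_term_le; try assumption.
  assert (INR k * 1 <= INR k * (2 * PI)) by (apply Rmult_le_compat_l; lra). lra. }
unfold lattice_sum. lra.
Qed.

Lemma Phi_succ_le (s x l m : R) : 1 <= s -> 0 < x ->
  (forall k, m ^ 2 <= (l + 2 * INR k * PI) ^ 2) -> Phi (s + 1) x l <= / (x + m ^ 2) * Phi s x l.
Proof.
intros Hs Hx Hm. unfold Phi. rewrite <- Series_scal_l. apply Series_le.
- intros k. split; [left; apply Rpower_pos|].
  replace (- (s + 1)) with (- (1) + - s) by ring. rewrite Rpower_plus.
  apply Rmult_le_compat_r; [left; apply Rpower_pos|].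
  assert (Hb := base_pos x m Hx). assert (Hc := base_pos x (l + 2 * INR k * PI) Hx). specialize (Hm k).
  rewrite Rpower_opp_1 by lra. apply Rinv_le_contravar; lra.
- apply (ex_series_scal (V := R_NormedModule)). now apply ex_series_Phi.
Qed.

(** On [[-PI, PI]], [l] is the point of its lattice nearest to 0, so a weighted average of
    [1 / (x + (l + 2 k PI)^2)] cannot exceed the value at [k = 0]. *)
Lemma lattice_sum_succ_le (s x l : R) : 1 <= s -> 0 < x -> - PI <= l <= PI ->
  lattice_sum (s + 1) x l <= / (x + l ^ 2) * lattice_sum s x l.
Proof.
intros Hs Hx Hl. assert (P := PI_RGT_0). unfold lattice_sum. rewrite Rmult_plus_distr_l.
apply Rplus_le_compat; apply Phi_succ_le; try assumption; intros k; assert (Hk := pos_INR k);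
  apply Rminus_le_0.
- replace (_ - _) with (4 * PI * (INR k * (l + INR k * PI))) by ring.
  apply Rmult_le_pos; [lra|].
  destruct k as [|k]; [simpl; lra|]. apply Rmult_le_pos; [assumption|].
  rewrite S_INR. assert (0 <= INR k * PI) by (apply Rmult_le_pos; [apply pos_INR | lra]). lra.
- replace (_ - _) with (4 * PI * (1 + INR k) * ((PI - l) + INR k * PI)) by ring.
  assert (0 <= INR k * PI) by (apply Rmult_le_pos; lra).
  apply Rmult_le_pos; [|lra]. apply Rmult_le_pos; lra.
Qed.

(** * Closed forms for the spectral density and its logarithmic derivative *)

Lemma series_eq (a : nat -> R) : ex_series a -> series a = Series a.
Proof.
intros E. apply the_real_eq.
- apply is_series_Reals, Series_correct, E.
- intros l' H. symmetry. now apply is_series_unique, is_series_Reals.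
Qed.

Lemma integral_eq (f : R -> R) (a b : R) : ex_RInt f a b -> integral f a b = RInt f a b.
Proof.
intros E. apply the_real_eq.
- exists (ex_RInt_Reals_0 _ _ _ E). symmetry. apply RInt_Reals.
- intros l' [pr <-]. symmetry. apply RInt_Reals.
Qed.

Lemma Deriv_eq (F : R -> R) (x l : R) : is_derive F x l -> Deriv F x = l.
Proof.
intros H. apply is_derive_Reals in H. apply the_real_eq; [assumption|].
intros l' H'. eapply uniqueness_limite; eassumption.
Qed.

Lemma C_nu_pos (nu : R) : 0 < nu -> 0 < C_nu nu.
Proof.
intros Hn. apply Rdiv_lt_0_compat; [apply Gamma_correct; lra|].
apply Rmult_lt_0_compat; [apply sqrt_lt_R0, PI_RGT_0 | now apply Gamma_correct].
Qed.

Lemma gdelta_eq (nu delta theta l : R) : / 2 <= nu -> 0 < delta * theta ->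
  gdelta nu delta theta l =
  C_nu nu * Rpower (delta * theta) (2 * nu) * lattice_sum (nu + / 2) ((delta * theta) ^ 2) l.
Proof.
intros Hn Ha. assert (Hx : 0 < (delta * theta) ^ 2) by now apply pow_lt.
set (K := C_nu nu * Rpower (delta * theta) (2 * nu)).
unfold gdelta, lattice_sum. rewrite Rmult_plus_distr_l. unfold gstar. fold K.
f_equal.
- unfold Phi. rewrite <- Series_scal_l. apply series_eq.
  apply (ex_series_scal (V := R_NormedModule)), ex_series_Phi; lra.
(* For the negative half, [l - 2 (k+1) PI] is the opposite of [2 PI - l + 2 k PI], so the squares
   agree. *)
- unfold Phi. rewrite <- Series_scal_l.
  rewrite <- (Series_ext (fun k => K * Rpower ((delta * theta) ^ 2 + (l - 2 * INR (S k) * PI) ^ 2) (- (nu + / 2)))).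
  + apply series_eq.
    apply (ex_series_ext (V := R_NormedModule) (fun k => K * Rpower ((delta * theta) ^ 2 + (2 * PI - l + 2 * INR k * PI) ^ 2) (- (nu + / 2)))).
    * intros k. rewrite S_INR. do 3 f_equal. ring.
    * apply (ex_series_scal (V := R_NormedModule)), ex_series_Phi; lra.
  + intros k. rewrite S_INR. do 3 f_equal. ring.
Qed.

(** The power of [delta * theta] contributes exactly [2 nu / theta], which cancels. The rest is the
    chain rule through [(delta * t)^2], with [2 s = 2 nu + 1]. *)
Lemma hdelta_eq (nu delta theta l : R) : / 2 <= nu -> 0 < delta -> 0 < theta ->
  hdelta nu delta theta l - 2 * nu / theta =
  - ((2 * nu + 1) / theta) * ((delta * theta) ^ 2 *
     (lattice_sum (nu + / 2 + 1) ((delta * theta) ^ 2) l / lattice_sum (nu + / 2) ((delta * theta) ^ 2) l)).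
Proof.
intros Hn Hd Ht.
assert (Ha : 0 < delta * theta) by now apply Rmult_lt_0_compat.
assert (Hx : 0 < (delta * theta) ^ 2) by now apply pow_lt.
assert (HC := C_nu_pos nu ltac:(lra)).
assert (HL := lattice_sum_pos (nu + / 2) _ l ltac:(lra) Hx).
set (s := nu + / 2) in *.
unfold hdelta.
rewrite (Deriv_eq _ _ (2 * nu / theta - (2 * nu + 1) / theta * ((delta * theta) ^ 2 *
  (lattice_sum (s + 1) ((delta * theta) ^ 2) l / lattice_sum s ((delta * theta) ^ 2) l)))); [ring|].
apply is_derive_ext_loc with
  (fun t => ln (C_nu nu) + 2 * nu * ln (delta * t) + ln (lattice_sum s ((delta * t) ^ 2) l)).
(* The logarithm splits only for [t > 0], hence the neighbourhood of radius [theta]. *)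
- exists (mkposreal theta Ht). intros t Hb. change (Rabs (t - theta) < theta) in Hb. apply Rabs_def2 in Hb.
  assert (Hat : 0 < delta * t) by (apply Rmult_lt_0_compat; lra).
  rewrite gdelta_eq by assumption. fold s.
  assert (HLt := lattice_sum_pos s ((delta * t) ^ 2) l ltac:(unfold s; lra) ltac:(now apply pow_lt)).
  assert (HR := Rpower_pos (delta * t) (2 * nu)).
  rewrite (ln_mult (C_nu nu * _)) by (assumption || now apply Rmult_lt_0_compat).
  rewrite (ln_mult (C_nu nu)) by assumption.
  unfold Rpower at 1. now rewrite ln_exp.
- assert (D1 : is_derive (fun t => lattice_sum s ((delta * t) ^ 2) l) theta
     (2 * delta ^ 2 * theta * (- s * lattice_sum (s + 1) ((delta * theta) ^ 2) l))).
  { apply (is_derive_comp (V := R_NormedModule) (fun x => lattice_sum s x l) (fun t => (delta * t) ^ 2)).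
    - apply is_derive_lattice_sum; [unfold s; lra | assumption].
    - auto_derive; [exact I | ring]. }
  set (G := fun t => lattice_sum s ((delta * t) ^ 2) l) in *.
  change (lattice_sum s ((delta * theta) ^ 2) l) with (G theta) in *.
  change (is_derive G theta (2 * delta ^ 2 * theta * (- s * lattice_sum (s + 1) ((delta * theta) ^ 2) l))) in D1.
  apply (is_derive_ext (fun t => ln (C_nu nu) + 2 * nu * ln (delta * t) + ln (G t))); [reflexivity|].
  auto_derive.
  + split; [exact Ha|]. split; [eexists; exact D1|]. split; [exact HL | exact I].
  + change (Derive (fun x => G x) theta) with (Derive G theta). rewrite (is_derive_unique _ _ _ D1). unfold s. field. repeat split; lra.
Qed.

(** * Asymptotic bounds *)

Lemma Rpower_scaled_kernel (s alpha l : R) : 0 < alpha ->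
  Rpower (alpha ^ 2 + l ^ 2) (- s) = Rpower alpha (- (2 * s)) * cauchy_kernel s (/ alpha * l).
Proof.
intros Ha. assert (H := one_plus_sq_ge (/ alpha * l)).
replace (alpha ^ 2 + l ^ 2) with (alpha ^ 2 * (1 + (/ alpha * l) ^ 2)) by (field; lra).
rewrite <- Rpower_mult_distr by (try apply pow_lt; lra).
rewrite <- Rpower_pow, Rpower_mult by assumption. unfold cauchy_kernel.
do 2 f_equal. simpl; ring.
Qed.

Lemma scaled_kernel_continuous (t alpha l : R) : continuous (fun l => cauchy_kernel t (/ alpha * l)) l.
Proof.
apply (continuous_comp (fun l => / alpha * l) (cauchy_kernel t)); [|apply cauchy_kernel_continuous].
apply (continuous_scal_r (V := R_NormedModule)), continuous_id.
Qed.

Lemma ex_RInt_continuous_all (f : R -> R) (a b : R) : (forall x, continuous f x) -> ex_RInt f a b.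
Proof. intros H. apply (ex_RInt_continuous (V := R_CompleteNormedModule)); auto. Qed.

Lemma RInt_cauchy_sym (t T : R) : RInt (cauchy_kernel t) (- T) T = 2 * RInt (cauchy_kernel t) 0 T.
Proof.
rewrite <- (RInt_Chasles (V := R_CompleteNormedModule) _ (- T) 0 T) by apply ex_RInt_cauchy_kernel.
assert (E := RInt_comp_lin (V := R_CompleteNormedModule) (cauchy_kernel t) (- 1) 0 0 T (ex_RInt_cauchy_kernel _ _ _)).
replace (-1 * 0 + 0) with 0 in E by ring. replace (-1 * T + 0) with (- T) in E by ring.
rewrite <- (opp_RInt_swap (V := R_CompleteNormedModule) (cauchy_kernel t) 0 (- T)), <- E by apply ex_RInt_cauchy_kernel.
rewrite (RInt_scal (V := R_CompleteNormedModule) (fun y => cauchy_kernel t (-1 * y + 0))).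
- rewrite (RInt_ext (V := R_CompleteNormedModule) (fun y => cauchy_kernel t (-1 * y + 0)) (cauchy_kernel t)).
  + unfold opp, scal, plus; simpl. unfold mult; simpl. ring.
  + intros y _. unfold cauchy_kernel. do 2 f_equal. ring.
- apply ex_RInt_continuous_all. intros x.
  apply (continuous_comp (fun y => -1 * y + 0) (cauchy_kernel t)); [|apply cauchy_kernel_continuous].
  apply (ex_derive_continuous (V := R_NormedModule)). auto_derive. exact I.
Qed.

Lemma RInt_scaled_kernel (t alpha T : R) : 0 < alpha ->
  RInt (fun l => cauchy_kernel t (/ alpha * l)) (- T) T = 2 * alpha * RInt (cauchy_kernel t) 0 (T / alpha).
Proof.
intros Ha.
assert (E := RInt_comp_lin (V := R_CompleteNormedModule) (cauchy_kernel t) (/ alpha) 0 (- T) T (ex_RInt_cauchy_kernel _ _ _)).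
replace (/ alpha * - T + 0) with (- (T / alpha)) in E by (field; lra).
replace (/ alpha * T + 0) with (T / alpha) in E by (field; lra).
rewrite RInt_cauchy_sym in E.
rewrite (RInt_ext (V := R_CompleteNormedModule) _ (fun l => scal (/ alpha) (cauchy_kernel t (/ alpha * l)))) in E.
2: { intros y _. now rewrite Rplus_0_r. }
rewrite (RInt_scal (V := R_CompleteNormedModule) (fun l => cauchy_kernel t (/ alpha * l))) in E.
2: { apply ex_RInt_continuous_all. intros x; apply scaled_kernel_continuous. }
change (/ alpha * RInt (fun l => cauchy_kernel t (/ alpha * l)) (- T) T = 2 * RInt (cauchy_kernel t) 0 (T / alpha)) in E.
apply (Rmult_eq_reg_l (/ alpha)); [|apply Rinv_neq_0_compat; lra].
transitivity (2 * RInt (cauchy_kernel t) 0 (T / alpha)); [exact E | field; lra].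
Qed.

Lemma integral_ext (f g : R -> R) (a b : R) :
  (forall x, f x = g x) -> (forall x, continuous g x) -> integral f a b = RInt g a b.
Proof.
intros E Hg.
rewrite <- (RInt_ext (V := R_CompleteNormedModule) f g) by auto.
apply integral_eq, (ex_RInt_ext (V := R_CompleteNormedModule) g); [auto | now apply ex_RInt_continuous_all].
Qed.

Section Asymptotics.

Context (nu delta theta b : R).
Context (Hnu : / 2 <= nu).
Context (Hdelta : 0 < delta).
Context (Htheta : 0 < theta).
Context (Hb : 0 < b).
Let alpha := delta * theta.
Let s := nu + / 2.
Let c := / (2 * PI).

Lemma alpha_pos : 0 < alpha.
Proof. now apply Rmult_lt_0_compat. Qed.

Lemma alpha2_pos : 0 < alpha ^ 2.
Proof. apply pow_lt, alpha_pos. Qed.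

Lemma c_pos : 0 < c.
Proof. apply Rinv_0_lt_compat. assert (H := PI_RGT_0). lra. Qed.

Lemma s_ge_1 : 1 <= s.
Proof. unfold s; lra. Qed.

Lemma gdelta_continuous (l : R) : continuous (gdelta nu delta theta) l.
Proof.
apply (continuous_ext (fun l => C_nu nu * Rpower alpha (2 * nu) * lattice_sum s (alpha ^ 2) l)).
- intros x. symmetry. apply gdelta_eq; [assumption | apply alpha_pos].
- apply (continuous_scal_r (V := R_NormedModule)), lattice_sum_continuous; [apply s_ge_1 | apply alpha2_pos].
Qed.

Lemma main_term_eq (l : R) :
  C_nu nu * Rpower alpha (2 * nu) * Rpower (alpha ^ 2 + l ^ 2) (- s) =
  C_nu nu / alpha * cauchy_kernel s (/ alpha * l).
Proof.
assert (Ha := alpha_pos).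
rewrite Rpower_scaled_kernel by assumption.
replace (C_nu nu / alpha) with (C_nu nu * (Rpower alpha (2 * nu) * Rpower alpha (- (2 * s)))); [ring|].
rewrite <- Rpower_plus. replace (2 * nu + - (2 * s)) with (- (1)) by (unfold s; field).
now rewrite Rpower_opp_1.
Qed.

Lemma gdelta_ge (l : R) : C_nu nu / alpha * cauchy_kernel s (/ alpha * l) <= gdelta nu delta theta l.
Proof.
rewrite <- main_term_eq, gdelta_eq by (assumption || apply alpha_pos).
apply Rmult_le_compat_l.
- left; apply Rmult_lt_0_compat; [apply C_nu_pos; lra | apply Rpower_pos].
- apply lattice_sum_ge; [apply s_ge_1 | apply alpha2_pos].
Qed.

Lemma Rpower_le_1 (t : R) : alpha <= 1 -> 0 <= t -> Rpower alpha t <= 1.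
Proof.
intros H Ht. rewrite <- exp_0. apply exp_le.
assert (ln alpha <= 0) by (rewrite <- ln_1; apply ln_le; [apply alpha_pos | lra]).
assert (0 <= t * - ln alpha) by (apply Rmult_le_pos; lra). lra.
Qed.

Lemma inv_sq_sum_nonneg : 0 <= inv_sq_sum.
Proof.
apply Series_nonneg; [|apply ex_series_inv_sq].
intros k. left; apply Rinv_0_lt_compat, pow_lt. assert (H := pos_INR k). lra.
Qed.

Lemma gdelta_le (l : R) : alpha <= 1 -> - PI <= l <= PI ->
  gdelta nu delta theta l <= C_nu nu / alpha * cauchy_kernel s (/ alpha * l) + 2 * C_nu nu * inv_sq_sum.
Proof.
intros H1 Hl. rewrite <- main_term_eq, gdelta_eq by (assumption || apply alpha_pos).
assert (HC := C_nu_pos nu ltac:(lra)).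
assert (HP := Rpower_pos alpha (2 * nu)).
assert (L := lattice_sum_le s (alpha ^ 2) l s_ge_1 alpha2_pos Hl).
apply (Rmult_le_compat_l (C_nu nu * Rpower alpha (2 * nu))) in L; [|left; now apply Rmult_lt_0_compat].
fold s alpha.
assert (B := Rpower_le_1 (2 * nu) H1 ltac:(lra)).
apply (Rmult_le_compat_r (2 * C_nu nu * inv_sq_sum)) in B.
- lra.
- apply Rmult_le_pos; [lra | apply inv_sq_sum_nonneg].
Qed.

Lemma gdelta_pos (l : R) : 0 < gdelta nu delta theta l.
Proof.
apply Rlt_le_trans with (2 := gdelta_ge l).
apply Rmult_lt_0_compat; [|apply cauchy_kernel_pos].
apply Rdiv_lt_0_compat; [apply C_nu_pos; lra | apply alpha_pos].
Qed.

(** * Bounds for the variance integral *)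

Lemma v1_eq : v1 nu delta b theta = RInt (fun l => (b * gdelta nu delta theta l + c) ^ 2) (- PI) PI.
Proof.
assert (Hc : forall l, continuous (fun l => (b * gdelta nu delta theta l + c) ^ 2) l).
{ intros l. apply (continuous_comp (gdelta nu delta theta) (fun g => (b * g + c) ^ 2)); [apply gdelta_continuous|].
  apply (ex_derive_continuous (V := R_NormedModule)). auto_derive. exact I. }
unfold v1.
(* Since [a = b g / (b g + c)], the quotient [g / a] is [(b g + c) / b]. *)
rewrite (integral_ext _ (fun l => / b ^ 2 * (b * gdelta nu delta theta l + c) ^ 2)).
- rewrite (RInt_scal (V := R_CompleteNormedModule) (fun l => (b * gdelta nu delta theta l + c) ^ 2) _ _ (/ b ^ 2))
    by now apply ex_RInt_continuous_all.
  unfold scal; simpl; unfold mult; simpl. field. lra.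
- intros l. unfold adelta. fold c. assert (Hg := gdelta_pos l). assert (Hc0 := c_pos).
  assert (0 < b * gdelta nu delta theta l) by now apply Rmult_lt_0_compat.
  field. repeat split; lra.
- intros l. now apply (continuous_scal_r (V := R_NormedModule)).
Qed.

Lemma cauchy_kernel_sq (t u : R) : cauchy_kernel t u ^ 2 = cauchy_kernel (2 * t) u.
Proof.
unfold cauchy_kernel. replace (- (2 * t)) with (- t + - t) by ring. rewrite Rpower_plus. ring.
Qed.

(** Drops the noise level [c] and all lattice terms but the central one. *)
Lemma v1_ge : 2 * b ^ 2 * C_nu nu ^ 2 * RInt (cauchy_kernel (2 * s)) 0 (PI / alpha) <= alpha * v1 nu delta b theta.
Proof.
assert (Ha := alpha_pos). assert (P := PI_RGT_0). assert (HC := C_nu_pos nu ltac:(lra)).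
assert (Hk : 0 < b * (C_nu nu / alpha)) by (apply Rmult_lt_0_compat; [|apply Rdiv_lt_0_compat]; lra).
rewrite v1_eq.
replace (2 * b ^ 2 * C_nu nu ^ 2 * RInt (cauchy_kernel (2 * s)) 0 (PI / alpha))
  with (alpha * ((b * (C_nu nu / alpha)) ^ 2 * (2 * alpha * RInt (cauchy_kernel (2 * s)) 0 (PI / alpha)))) by (field; lra).
apply Rmult_le_compat_l; [lra|]. rewrite <- RInt_scaled_kernel by assumption.
rewrite <- (RInt_scal (V := R_CompleteNormedModule) (fun l => cauchy_kernel (2 * s) (/ alpha * l)) _ _ ((b * (C_nu nu / alpha)) ^ 2)).
2: { apply ex_RInt_continuous_all. intros; apply scaled_kernel_continuous. }
apply RInt_le; [lra | | |].
- apply ex_RInt_continuous_all. intros. apply (continuous_scal_r (V := R_NormedModule)), scaled_kernel_continuous.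
- apply ex_RInt_continuous_all. intros l. apply (continuous_comp (gdelta nu delta theta) (fun g => (b * g + c) ^ 2)); [apply gdelta_continuous|].
  apply (ex_derive_continuous (V := R_NormedModule)). auto_derive. exact I.
- intros l _. unfold scal; simpl; unfold mult; simpl. rewrite <- cauchy_kernel_sq.
  replace (b * (C_nu nu / alpha) * (b * (C_nu nu / alpha) * 1) * cauchy_kernel s (/ alpha * l) ^ 2)
    with ((b * (C_nu nu / alpha * cauchy_kernel s (/ alpha * l))) ^ 2) by ring.
  assert (G := gdelta_ge l). assert (Hc0 := c_pos).
  assert (K := cauchy_kernel_pos s (/ alpha * l)).
  apply (Rmult_le_compat_l b) in G; [|lra].
  assert (0 <= b * (C_nu nu / alpha * cauchy_kernel s (/ alpha * l))).
  { rewrite <- Rmult_assoc. apply Rmult_le_pos; lra. }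
  change ((b * gdelta nu delta theta l + c) * ((b * gdelta nu delta theta l + c) * 1))
    with ((b * gdelta nu delta theta l + c) ^ 2).
  apply pow_incr. lra.
Qed.

(** Everything in [b * gdelta + c] beyond the central term, bounded uniformly in [l]. *)
Let D := 2 * b * C_nu nu * inv_sq_sum + c.

(** Integrates [(k K1 + D)^2]: the square of [k K1] is the main term, while the cross term and [D^2]
    integrate to bounded quantities, so the factor [alpha] kills them. *)
Lemma v1_le : alpha <= 1 ->
  alpha * v1 nu delta b theta <=
  2 * b ^ 2 * C_nu nu ^ 2 * RInt (cauchy_kernel (2 * s)) 0 (PI / alpha) +
  alpha * (4 * D * b * C_nu nu * cauchy_int s + 2 * PI * D ^ 2).
Proof.
intros H1.
assert (Ha := alpha_pos). assert (P := PI_RGT_0). assert (HC := C_nu_pos nu ltac:(lra)).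
assert (HD : 0 < D).
{ unfold D. assert (Hc0 := c_pos). assert (0 <= 2 * b * C_nu nu * inv_sq_sum); [|lra].
  apply Rmult_le_pos; [|apply inv_sq_sum_nonneg]. left. apply Rmult_lt_0_compat; lra. }
set (k := b * (C_nu nu / alpha)).
assert (Hk : 0 < k) by (apply Rmult_lt_0_compat; [|apply Rdiv_lt_0_compat]; lra).
set (K1 := fun l => cauchy_kernel s (/ alpha * l)).
set (K2 := fun l => cauchy_kernel (2 * s) (/ alpha * l)).
assert (E1 : forall m x, continuous (fun l => m * K1 l) x).
{ intros. apply (continuous_scal_r (V := R_NormedModule)), scaled_kernel_continuous. }
assert (E2 : forall m x, continuous (fun l => m * K2 l) x).
{ intros. apply (continuous_scal_r (V := R_NormedModule)), scaled_kernel_continuous. }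
assert (E12 : forall x, continuous (fun l => k ^ 2 * K2 l + 2 * D * k * K1 l) x).
{ intros. now apply (continuous_plus (V := R_NormedModule) (fun l => k ^ 2 * K2 l) (fun l => 2 * D * k * K1 l)). }
assert (L : v1 nu delta b theta <= RInt (fun l => k ^ 2 * K2 l + 2 * D * k * K1 l + D ^ 2) (- PI) PI).
{ rewrite v1_eq. apply RInt_le; [lra | | |].
  - apply ex_RInt_continuous_all. intros l.
    apply (continuous_comp (gdelta nu delta theta) (fun g => (b * g + c) ^ 2)); [apply gdelta_continuous|].
    apply (ex_derive_continuous (V := R_NormedModule)). auto_derive. exact I.
  - apply ex_RInt_continuous_all. intros l.
    apply (continuous_plus (V := R_NormedModule) (fun l => k ^ 2 * K2 l + 2 * D * k * K1 l) (fun _ => D ^ 2));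
      [apply E12 | apply continuous_const].
  - intros l Hl. unfold K2. rewrite <- cauchy_kernel_sq. fold (K1 l).
    replace (k ^ 2 * K1 l ^ 2 + 2 * D * k * K1 l + D ^ 2) with ((k * K1 l + D) ^ 2) by ring.
    assert (G := gdelta_le l H1 ltac:(lra)). apply (Rmult_le_compat_l b) in G; [|lra].
    assert (Hg : 0 < b * gdelta nu delta theta l) by (apply Rmult_lt_0_compat; [lra | apply gdelta_pos]).
    assert (Hc0 := c_pos).
    apply pow_incr. split; [lra|]. unfold k, D, K1. lra. }
rewrite (RInt_plus (V := R_CompleteNormedModule) (fun l => k ^ 2 * K2 l + 2 * D * k * K1 l) (fun _ => D ^ 2)) in L
  by (apply ex_RInt_const || now apply ex_RInt_continuous_all).
rewrite (RInt_plus (V := R_CompleteNormedModule) (fun l => k ^ 2 * K2 l) (fun l => 2 * D * k * K1 l)) in L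
  by now apply ex_RInt_continuous_all.
rewrite (RInt_scal (V := R_CompleteNormedModule) K1) in L
  by (apply ex_RInt_continuous_all; intros; apply scaled_kernel_continuous).
rewrite (RInt_scal (V := R_CompleteNormedModule) K2) in L
  by (apply ex_RInt_continuous_all; intros; apply scaled_kernel_continuous).
unfold K1, K2 in L. rewrite RInt_const, !RInt_scaled_kernel in L by assumption.
unfold plus, scal in L; simpl in L; unfold mult in L; simpl in L.
assert (B := RInt_cauchy_le s (PI / alpha) s_ge_1 ltac:(apply Rdiv_lt_0_compat; lra)).
apply (Rmult_le_compat_l (2 * D * k * (2 * alpha))) in B.
2: { left. apply Rmult_lt_0_compat; [|lra]. apply Rmult_lt_0_compat; lra. }
apply (Rmult_le_compat_l alpha) in L; [|lra].
apply (Rmult_le_compat_l alpha) in B; [|lra].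
apply Rle_trans with (1 := L).
replace (2 * b ^ 2 * C_nu nu ^ 2 * RInt (cauchy_kernel (2 * s)) 0 (PI / alpha))
  with (alpha * (k ^ 2 * (2 * alpha * RInt (cauchy_kernel (2 * s)) 0 (PI / alpha)))) by (unfold k; field; lra).
replace (alpha * (4 * D * b * C_nu nu * cauchy_int s + 2 * PI * D ^ 2))
  with (alpha * (2 * D * k * (2 * alpha) * cauchy_int s) + alpha * (2 * PI * D ^ 2)) by (unfold k; field; lra).
lra.
Qed.

(** * Bounds for the information integral *)

Let q (l : R) : R := alpha ^ 2 * (lattice_sum (s + 1) (alpha ^ 2) l / lattice_sum s (alpha ^ 2) l).
Let a (l : R) : R := adelta nu delta b theta l.

Definition info_integral : R :=
  integral (fun l => adelta nu delta b theta l ^ 2 * (hdelta nu delta theta l - 2 * nu / theta) ^ 2) (- PI) PI.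

Lemma aq_continuous (l : R) : continuous (fun l => (a l * q l) ^ 2) l.
Proof.
apply (continuous_comp (fun l => a l * q l) (fun y => y ^ 2)).
2: { apply (ex_derive_continuous (V := R_NormedModule)). auto_derive. exact I. }
apply (continuous_mult (K := R_AbsRing) a q).
- unfold a. apply (continuous_comp (gdelta nu delta theta) (fun g => b * g / (b * g + / (2 * PI)))).
  + apply gdelta_continuous.
  + apply (ex_derive_continuous (V := R_NormedModule)). auto_derive.
    assert (H : 0 < b * gdelta nu delta theta l) by (apply Rmult_lt_0_compat; [lra | apply gdelta_pos]).
    assert (Hc := c_pos). unfold c in Hc. lra.
- apply (continuous_scal_r (V := R_NormedModule) (alpha ^ 2)).
  apply (continuous_mult (K := R_AbsRing) (lattice_sum (s + 1) (alpha ^ 2)) (fun l => / lattice_sum s (alpha ^ 2) l)).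
  + apply lattice_sum_continuous; [unfold s; lra | apply alpha2_pos].
  + apply (continuous_Rinv_comp (lattice_sum s (alpha ^ 2))).
    * apply lattice_sum_continuous; [apply s_ge_1 | apply alpha2_pos].
    * apply Rgt_not_eq, lattice_sum_pos; [apply s_ge_1 | apply alpha2_pos].
Qed.

Lemma info_integral_eq :
  info_integral = ((2 * nu + 1) / theta) ^ 2 * RInt (fun l => (a l * q l) ^ 2) (- PI) PI.
Proof.
unfold info_integral.
rewrite (integral_ext _ (fun l => ((2 * nu + 1) / theta) ^ 2 * (a l * q l) ^ 2)).
- apply (RInt_scal (V := R_CompleteNormedModule) (fun l => (a l * q l) ^ 2)).
  apply ex_RInt_continuous_all, aq_continuous.
- intros l. rewrite hdelta_eq by assumption. unfold a, q, s, alpha. ring.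
- intros l. apply (continuous_scal_r (V := R_NormedModule)), aq_continuous.
Qed.

Lemma aq_nonneg (l : R) : 0 <= a l * q l.
Proof.
apply Rmult_le_pos.
- unfold a, adelta. fold c. assert (H : 0 < b * gdelta nu delta theta l) by (apply Rmult_lt_0_compat; [lra | apply gdelta_pos]).
  assert (Hc := c_pos). left; apply Rdiv_lt_0_compat; lra.
- unfold q. assert (Hx := alpha2_pos). apply Rmult_le_pos; [lra|].
  left; apply Rdiv_lt_0_compat; apply lattice_sum_pos; unfold s; lra.
Qed.

Lemma scaled_kernel_1 (l : R) : alpha ^ 2 * / (alpha ^ 2 + l ^ 2) = cauchy_kernel 1 (/ alpha * l).
Proof.
assert (Ha := alpha_pos). assert (H := base_pos (alpha ^ 2) l alpha2_pos).
assert (H1 := one_plus_sq_ge (/ alpha * l)).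
rewrite cauchy_kernel_1. field. repeat split; lra.
Qed.

Lemma aq_le (l : R) : - PI <= l <= PI -> a l * q l <= cauchy_kernel 1 (/ alpha * l).
Proof.
intros Hl. assert (Hx := alpha2_pos).
assert (Hg : 0 < b * gdelta nu delta theta l) by (apply Rmult_lt_0_compat; [lra | apply gdelta_pos]).
assert (Hc := c_pos).
rewrite <- (Rmult_1_l (cauchy_kernel _ _)). apply Rmult_le_compat.
- unfold a, adelta; fold c. left; apply Rdiv_lt_0_compat; lra.
- unfold q. apply Rmult_le_pos; [lra|].
  left; apply Rdiv_lt_0_compat; apply lattice_sum_pos; unfold s; lra.
- unfold a, adelta; fold c. apply (Rmult_le_reg_r (b * gdelta nu delta theta l + c)); [lra|].
  unfold Rdiv. rewrite Rmult_assoc, Rinv_l by lra. lra.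
- rewrite <- scaled_kernel_1. unfold q. apply Rmult_le_compat_l; [lra|].
  assert (L := lattice_sum_succ_le s (alpha ^ 2) l s_ge_1 Hx Hl).
  assert (LP := lattice_sum_pos s (alpha ^ 2) l s_ge_1 Hx).
  apply (Rmult_le_reg_r (lattice_sum s (alpha ^ 2) l)); [assumption|].
  unfold Rdiv. rewrite (Rmult_assoc (lattice_sum (s + 1) _ _)), Rinv_l by lra. lra.
Qed.

Lemma RInt_aq_le : RInt (fun l => (a l * q l) ^ 2) (- PI) PI <= 2 * alpha * cauchy_int 2.
Proof.
assert (Ha := alpha_pos). assert (P := PI_RGT_0).
apply Rle_trans with (RInt (fun l => cauchy_kernel 2 (/ alpha * l)) (- PI) PI).
- apply RInt_le; [lra | apply ex_RInt_continuous_all, aq_continuous |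
    apply ex_RInt_continuous_all; intros; apply scaled_kernel_continuous |].
  intros l Hl. replace (cauchy_kernel 2 (/ alpha * l)) with (cauchy_kernel 1 (/ alpha * l) ^ 2)
    by (rewrite cauchy_kernel_sq; f_equal; ring).
  apply pow_incr. split; [apply aq_nonneg | apply aq_le; lra].
- rewrite RInt_scaled_kernel by assumption. apply Rmult_le_compat_l; [lra|].
  apply RInt_cauchy_le; [lra | apply Rdiv_lt_0_compat; lra].
Qed.

(* [k] is the kernel at the cutoff [U]; both loss factors tend to 1 as [alpha -> 0] with [U] fixed. *)
Lemma aq_ge (U l : R) : alpha <= 1 -> - PI <= l <= PI -> - (alpha * U) <= l <= alpha * U ->
  let k := cauchy_kernel s U in
  (b * C_nu nu * k / (b * C_nu nu * k + c * alpha)) * (k / (k + 2 * inv_sq_sum * alpha)) *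
    cauchy_kernel 1 (/ alpha * l) <= a l * q l.
Proof.
intros H1 Hl HU k.
assert (Ha := alpha_pos). assert (Hx := alpha2_pos). assert (HC := C_nu_pos nu ltac:(lra)).
assert (Hc := c_pos). assert (HM := inv_sq_sum_nonneg).
assert (Hk : 0 < k) by apply cauchy_kernel_pos.
assert (HbCk : 0 < b * C_nu nu * k) by (apply Rmult_lt_0_compat; [apply Rmult_lt_0_compat|]; lra).
assert (Hca : 0 < c * alpha) by now apply Rmult_lt_0_compat.
assert (HMa : 0 <= inv_sq_sum * alpha) by (apply Rmult_le_pos; lra).
set (u := / alpha * l).
assert (Hu : u ^ 2 <= U ^ 2).
{ assert (El : l = alpha * u) by (unfold u; field; lra).
  assert (- U <= u <= U).
  { split; apply (Rmult_le_reg_l alpha); try lra. }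
  rewrite <- (pow2_abs u), <- (pow2_abs U). apply pow_incr. split; [apply Rabs_pos|].
  apply Rle_trans with U; [apply Rabs_le; lra | apply Rle_abs]. }
assert (Hku : k <= cauchy_kernel s u).
{ apply Rpower_opp_le; [unfold s; lra|]. assert (H := one_plus_sq_ge u). lra. }
rewrite Rmult_assoc. apply Rmult_le_compat.
- left; apply Rdiv_lt_0_compat; lra.
- apply Rmult_le_pos; [left; apply Rdiv_lt_0_compat; lra | left; apply cauchy_kernel_pos].
- unfold a, adelta; fold c.
  assert (G := gdelta_ge l). fold u in G.
  (* [y / (y + c alpha)] increases in [y], so a lower bound on [alpha * b * gdelta] suffices. *)
  assert (G2 : b * C_nu nu * k <= alpha * (b * gdelta nu delta theta l)).
  { apply Rle_trans with (alpha * (b * (C_nu nu / alpha * cauchy_kernel s u))).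
    - replace (alpha * _) with (b * C_nu nu * cauchy_kernel s u) by (field; lra).
      apply Rmult_le_compat_l; [left; apply Rmult_lt_0_compat; lra | assumption].
    - repeat (apply Rmult_le_compat_l; [lra|]). exact G. }
  set (g := b * gdelta nu delta theta l) in *.
  assert (Hg : 0 < g) by (apply Rmult_lt_0_compat; [lra | apply gdelta_pos]).
  apply Rminus_le_0.
  replace (_ - _) with (c * (alpha * g - b * C_nu nu * k) * / ((g + c) * (b * C_nu nu * k + c * alpha))) by (field; lra).
  apply Rmult_le_pos; [apply Rmult_le_pos; lra|]. left; apply Rinv_0_lt_compat, Rmult_lt_0_compat; lra.
- assert (HL := lattice_sum_le s (alpha ^ 2) l s_ge_1 Hx Hl).
  assert (HG := lattice_sum_ge (s + 1) (alpha ^ 2) l ltac:(unfold s; lra) Hx).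
  assert (HLp := lattice_sum_pos s (alpha ^ 2) l s_ge_1 Hx).
  set (p := Rpower (alpha ^ 2 + l ^ 2) (- s)) in *.
  assert (Hp0 : 0 < p) by apply Rpower_pos.
  assert (Ep : Rpower (alpha ^ 2 + l ^ 2) (- (s + 1)) = p * / (alpha ^ 2 + l ^ 2)).
  { replace (- (s + 1)) with (- s + - (1)) by ring. rewrite Rpower_plus, Rpower_opp_1; [reflexivity|].
    now apply base_pos. }
  rewrite Ep in HG.
  (* [alpha * p] is the kernel at [u] times [alpha^(-2 nu)], which is at least 1 for
     [alpha <= 1]. *)
  assert (Hpk : k <= alpha * p).
  { unfold p. rewrite Rpower_scaled_kernel by assumption. fold u.
    assert (1 <= alpha * Rpower alpha (- (2 * s))).
    { rewrite <- (Rpower_1 alpha) at 1 by assumption. rewrite <- Rpower_plus.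
      replace (1 + - (2 * s)) with (- (2 * nu)) by (unfold s; field). rewrite Rpower_Ropp.
      rewrite <- Rinv_1 at 1. apply Rinv_le_contravar; [apply Rpower_pos | apply Rpower_le_1; lra]. }
    apply Rle_trans with (1 * cauchy_kernel s u); [lra|].
    rewrite <- Rmult_assoc. apply Rmult_le_compat_r; [left; apply cauchy_kernel_pos | assumption]. }
  unfold u, q. rewrite <- scaled_kernel_1.
  replace (k / (k + 2 * inv_sq_sum * alpha) * (alpha ^ 2 * / (alpha ^ 2 + l ^ 2)))
    with (alpha ^ 2 * (/ (alpha ^ 2 + l ^ 2) * (k / (k + 2 * inv_sq_sum * alpha)))) by ring.
  apply Rmult_le_compat_l; [lra|].
  assert (Hi : 0 < / (alpha ^ 2 + l ^ 2)) by (apply Rinv_0_lt_compat; now apply base_pos).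
  (* Central term of the numerator over an upper bound of the denominator;
     [p / (p + 2 * inv_sq_sum)] increases in [p], and [p >= k / alpha]. *)
  apply Rle_trans with (p * / (alpha ^ 2 + l ^ 2) / (p + 2 * inv_sq_sum)).
  + replace (p * / (alpha ^ 2 + l ^ 2) / (p + 2 * inv_sq_sum))
      with (/ (alpha ^ 2 + l ^ 2) * (p / (p + 2 * inv_sq_sum))) by (unfold Rdiv; ring).
    apply Rmult_le_compat_l; [lra|]. apply Rminus_le_0.
    replace (_ - _) with (2 * inv_sq_sum * (alpha * p - k) * / ((p + 2 * inv_sq_sum) * (k + 2 * inv_sq_sum * alpha))) by (field; lra).
    apply Rmult_le_pos; [apply Rmult_le_pos; lra|]. left; apply Rinv_0_lt_compat, Rmult_lt_0_compat; lra.
  + apply Rmult_le_compat.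
    * left; now apply Rmult_lt_0_compat.
    * left; apply Rinv_0_lt_compat; lra.
    * exact HG.
    * apply Rinv_le_contravar; lra.
Qed.

(** Keeps only the window where [u = l / alpha] stays in [[-U, U]], on which the loss factors are
    uniform; the rest is nonnegative. *)
Lemma RInt_aq_ge (U : R) : alpha <= 1 -> 0 < U -> alpha * U <= PI ->
  let k := cauchy_kernel s U in
  2 * alpha * ((b * C_nu nu * k / (b * C_nu nu * k + c * alpha)) * (k / (k + 2 * inv_sq_sum * alpha))) ^ 2 *
    RInt (cauchy_kernel 2) 0 U <= RInt (fun l => (a l * q l) ^ 2) (- PI) PI.
Proof.
intros H1 HU HUP k. set (m := b * C_nu nu * k / _ * (k / _)).
assert (Ha := alpha_pos). assert (P := PI_RGT_0). assert (HC := C_nu_pos nu ltac:(lra)).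
assert (Hc := c_pos). assert (HM := inv_sq_sum_nonneg).
assert (HaU : 0 < alpha * U) by now apply Rmult_lt_0_compat.
assert (Hm : 0 <= m).
{ assert (Hk : 0 < k) by apply cauchy_kernel_pos.
  assert (HbCk : 0 < b * C_nu nu * k) by (apply Rmult_lt_0_compat; [apply Rmult_lt_0_compat|]; lra).
  assert (Hca : 0 < c * alpha) by now apply Rmult_lt_0_compat.
  assert (HMa : 0 <= inv_sq_sum * alpha) by (apply Rmult_le_pos; lra).
  unfold m. apply Rmult_le_pos; left; apply Rdiv_lt_0_compat; lra. }
assert (EI : forall x y, ex_RInt (fun l => (a l * q l) ^ 2) x y).
{ intros; apply ex_RInt_continuous_all, aq_continuous. }
rewrite <- (RInt_Chasles (V := R_CompleteNormedModule) _ (- PI) (- (alpha * U)) PI) by apply EI.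
rewrite <- (RInt_Chasles (V := R_CompleteNormedModule) _ (- (alpha * U)) (alpha * U) PI) by apply EI.
unfold plus; simpl (_ + _).
assert (N1 : 0 <= RInt (fun l => (a l * q l) ^ 2) (- PI) (- (alpha * U))).
{ apply RInt_ge_0; [lra | apply EI | intros; apply pow2_ge_0]. }
assert (N2 : 0 <= RInt (fun l => (a l * q l) ^ 2) (alpha * U) PI).
{ apply RInt_ge_0; [lra | apply EI | intros; apply pow2_ge_0]. }
assert (L : RInt (fun l => m ^ 2 * cauchy_kernel 2 (/ alpha * l)) (- (alpha * U)) (alpha * U) <=
            RInt (fun l => (a l * q l) ^ 2) (- (alpha * U)) (alpha * U)).
{ apply RInt_le; [lra | | apply EI |].
  - apply ex_RInt_continuous_all. intros. apply (continuous_scal_r (V := R_NormedModule)), scaled_kernel_continuous.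
  - intros l Hl. replace (cauchy_kernel 2 (/ alpha * l)) with (cauchy_kernel 1 (/ alpha * l) ^ 2)
      by (rewrite cauchy_kernel_sq; f_equal; ring).
    rewrite <- Rpow_mult_distr. apply pow_incr. split.
    + apply Rmult_le_pos; [assumption | left; apply cauchy_kernel_pos].
    + apply aq_ge; lra. }
rewrite (RInt_scal (V := R_CompleteNormedModule) (fun l => cauchy_kernel 2 (/ alpha * l)) _ _ (m ^ 2)) in L
  by (apply ex_RInt_continuous_all; intros; apply scaled_kernel_continuous).
rewrite RInt_scaled_kernel in L by assumption.
replace (alpha * U / alpha) with U in L by (field; lra).
unfold scal in L; simpl in L; unfold mult in L; simpl in L.
change (RInt (fun l => (a l * q l) ^ 2)) with (RInt (fun l => a l * q l * (a l * q l * 1))) in *.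
simpl. lra.
Qed.

End Asymptotics.

(** * Limits *)

Lemma at_right_0_lt (d : R) : 0 < d -> at_right 0 (fun x => 0 < x < d).
Proof.
intros Hd. exists (mkposreal d Hd). intros y Hy Hy0.
change (Rabs (y - 0) < d) in Hy. apply Rabs_def2 in Hy; lra.
Qed.

Lemma filterlim_squeeze {F : (R -> Prop) -> Prop} {FF : Filter F} (f g h : R -> R) (l : R) :
  F (fun x => f x <= g x <= h x) -> filterlim f F (locally l) -> filterlim h F (locally l) ->
  filterlim g F (locally l).
Proof.
intros H Hf Hh. apply filterlim_locally. intros eps.
assert (Ef := proj1 (filterlim_locally f l) Hf eps). assert (Eh := proj1 (filterlim_locally h l) Hh eps).
generalize (filter_and _ _ H (filter_and _ _ Ef Eh)). apply filter_imp.
intros x (Hx & H1 & H2). change (Rabs (f x - l) < eps) in H1. change (Rabs (h x - l) < eps) in H2.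
change (Rabs (g x - l) < eps). apply Rabs_def2 in H1. apply Rabs_def2 in H2. apply Rabs_def1; lra.
Qed.

Lemma filterlim_Rmult {F : (R -> Prop) -> Prop} {FF : Filter F} (f g : R -> R) (x y : R) :
  filterlim f F (locally x) -> filterlim g F (locally y) ->
  filterlim (fun t => f t * g t) F (locally (x * y)).
Proof. intros Hf Hg. exact (filterlim_comp_2 f g Rmult Hf Hg (filterlim_mult (K := R_AbsRing) x y)). Qed.

Lemma filterlim_Rplus {F : (R -> Prop) -> Prop} {FF : Filter F} (f g : R -> R) (x y : R) :
  filterlim f F (locally x) -> filterlim g F (locally y) ->
  filterlim (fun t => f t + g t) F (locally (x + y)).
Proof. intros Hf Hg. exact (filterlim_comp_2 f g Rplus Hf Hg (filterlim_plus (V := R_NormedModule) x y)). Qed.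

Lemma filterlim_div_at_right_0 (A theta : R) : 0 < A -> 0 < theta ->
  filterlim (fun d => A / (d * theta)) (at_right 0) (Rbar_locally p_infty).
Proof.
intros HA Ht P [M HM].
assert (HM1 : 0 < Rabs M + 1) by (assert (H := Rabs_pos M); lra).
assert (Hd : 0 < A / (theta * (Rabs M + 1))) by (apply Rdiv_lt_0_compat; [|apply Rmult_lt_0_compat]; lra).
unfold filtermap. generalize (at_right_0_lt _ Hd). apply filter_imp. intros d Hdd. apply HM.
apply Rle_lt_trans with (1 := Rle_abs M). apply Rlt_trans with (Rabs M + 1); [lra|].
assert (Hdt : 0 < d * theta) by (apply Rmult_lt_0_compat; lra).
apply (Rmult_lt_reg_r (d * theta)); [assumption|].
replace (A / (d * theta) * (d * theta)) with (A / (theta * (Rabs M + 1)) * (theta * (Rabs M + 1))) by (field; lra).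
replace ((Rabs M + 1) * (d * theta)) with (d * (theta * (Rabs M + 1))) by ring.
apply Rmult_lt_compat_r; [apply Rmult_lt_0_compat|]; lra.
Qed.

Lemma v1_limit (nu theta b : R) : / 2 <= nu -> 0 < theta -> 0 < b ->
  filterlim (fun delta => delta * theta * v1 nu delta b theta) (at_right 0)
    (locally (2 * b ^ 2 * C_nu nu ^ 2 * cauchy_int (2 * nu + 1))).
Proof.
intros Hn Ht Hb.
set (c0 := 2 * b ^ 2 * C_nu nu ^ 2).
set (D := 2 * b * C_nu nu * inv_sq_sum + / (2 * PI)).
set (E := 4 * D * b * C_nu nu * cauchy_int (nu + / 2) + 2 * PI * D ^ 2).
set (low := fun delta => c0 * RInt (cauchy_kernel (2 * (nu + / 2))) 0 (PI / (delta * theta))).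
assert (Hlow : filterlim low (at_right 0) (locally (c0 * cauchy_int (2 * nu + 1)))).
{ apply filterlim_Rmult; [apply filterlim_const|].
  replace (2 * nu + 1) with (2 * (nu + / 2)) by field.
  apply (filterlim_comp _ _ _ (fun delta => PI / (delta * theta)) (fun T => RInt (cauchy_kernel (2 * (nu + / 2))) 0 T)
    _ (Rbar_locally p_infty)).
  - apply filterlim_div_at_right_0; [apply PI_RGT_0 | assumption].
  - apply RInt_cauchy_lim. lra. }
(* The upper bound is the lower one plus [O(delta)], so both have the same limit. *)
apply (filterlim_squeeze low _ (fun delta => low delta + delta * theta * E)).
- assert (H1 : 0 < / theta) by now apply Rinv_0_lt_compat.
  generalize (at_right_0_lt _ H1). apply filter_imp. intros delta [Hd0 Hd1].
  split; [now apply v1_ge | apply v1_le; try assumption].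
  rewrite <- (Rinv_l theta) by lra. apply Rmult_le_compat_r; lra.
- exact Hlow.
- rewrite <- (Rplus_0_r (c0 * _)). apply filterlim_Rplus; [exact Hlow|].
  replace 0 with (0 * theta * E) at 2 by ring.
  apply (filterlim_at_right_continuous (fun delta => delta * theta * E)).
  apply (ex_derive_continuous (V := R_NormedModule)). auto_derive. exact I.
Qed.

Lemma info_integral_limit (nu theta b : R) : / 2 <= nu -> 0 < theta -> 0 < b ->
  filterlim (fun delta => info_integral nu delta theta b / (delta * theta)) (at_right 0)
    (locally (((2 * nu + 1) / theta) ^ 2 * (PI / 2))).
Proof.
intros Hn Ht Hb.
set (K := ((2 * nu + 1) / theta) ^ 2).
assert (HK : 0 < K) by (apply pow_lt, Rdiv_lt_0_compat; lra).
assert (HC := C_nu_pos nu ltac:(lra)). assert (HM := inv_sq_sum_nonneg). assert (P := PI_RGT_0).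
apply filterlim_locally. intros eps.
(* The tail beyond [U] then costs less than [eps / 2] in [2 K I]; the other half of [eps] goes to
   [low delta] against [low 0]. *)
assert (He : 0 < eps / (4 * K)) by (apply Rdiv_lt_0_compat; [apply cond_pos | lra]).
destruct (RInt_cauchy_lim 2 ltac:(lra) (ball (cauchy_int 2) (mkposreal _ He)) (locally_ball _ _)) as [M HU].
set (U := Rmax M 0 + 1).
assert (HU0 : 0 < U) by (assert (H := Rmax_r M 0); unfold U; lra).
specialize (HU U ltac:(assert (H := Rmax_l M 0); unfold U; lra)).
change (Rabs (RInt (cauchy_kernel 2) 0 U - cauchy_int 2) < eps / (4 * K)) in HU.
rewrite cauchy_int_2 in HU. set (I := RInt (cauchy_kernel 2) 0 U) in *.
set (k := cauchy_kernel (nu + / 2) U).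
assert (Hk : 0 < k) by apply cauchy_kernel_pos.
set (A := b * C_nu nu * k).
assert (HA : 0 < A) by (apply Rmult_lt_0_compat; [apply Rmult_lt_0_compat|]; lra).
(* With [U] fixed this expression is continuous up to [delta = 0], where both loss factors equal
   1. *)
set (low := fun delta => K * (2 * (A / (A + / (2 * PI) * (delta * theta)) * (k / (k + 2 * inv_sq_sum * (delta * theta)))) ^ 2 * I)).
assert (Hlow : filterlim low (at_right 0) (locally (low 0))).
{ apply filterlim_at_right_continuous, (ex_derive_continuous (V := R_NormedModule)).
  unfold low. auto_derive. rewrite !Rmult_0_l, !Rmult_0_r, !Rplus_0_r. repeat split; lra. }
assert (L0 : low 0 = K * (2 * I)).
{ unfold low. rewrite !Rmult_0_l, !Rmult_0_r, !Rplus_0_r. field. split; lra. }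
assert (He2 : 0 < eps / 2) by (apply Rdiv_lt_0_compat; [apply cond_pos | lra]).
assert (Elow := proj1 (filterlim_locally _ _) Hlow (mkposreal _ He2)).
(* The first bound gives [alpha <= 1], the second keeps the window [alpha * U] inside
   [[-PI, PI]]. *)
assert (Hd : 0 < Rmin (/ theta) (PI / (theta * U))).
{ apply Rmin_glb_lt; [now apply Rinv_0_lt_compat | apply Rdiv_lt_0_compat; [assumption | now apply Rmult_lt_0_compat]]. }
generalize (filter_and _ _ Elow (at_right_0_lt _ Hd)). apply filter_imp.
intros delta [H1 [Hd0 Hd1]].
change (Rabs (low delta - low 0) < eps / 2) in H1. apply Rabs_def2 in H1. rewrite L0 in H1.
assert (M1 := Rmin_l (/ theta) (PI / (theta * U))). assert (M2 := Rmin_r (/ theta) (PI / (theta * U))).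
assert (Ha : 0 < delta * theta) by now apply Rmult_lt_0_compat.
assert (Ha1 : delta * theta <= 1).
{ rewrite <- (Rinv_l theta) by lra. apply Rmult_le_compat_r; lra. }
assert (HaU : delta * theta * U <= PI).
{ replace PI with (PI / (theta * U) * (theta * U)) by (field; lra). rewrite Rmult_assoc.
  apply Rmult_le_compat_r; [left; now apply Rmult_lt_0_compat | lra]. }
assert (Up := RInt_aq_le nu delta theta b Hn Hd0 Ht Hb).
assert (Lo := RInt_aq_ge nu delta theta b Hn Hd0 Ht Hb U Ha1 HU0 HaU). cbv zeta in Lo.
assert (Eq := info_integral_eq nu delta theta b Hn Hd0 Ht Hb). fold K in Eq.
fold k A I in Lo. rewrite cauchy_int_2 in Up.
set (J := RInt _ (- PI) PI) in *.
change (Rabs (info_integral nu delta theta b / (delta * theta) - K * (PI / 2)) < eps).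
rewrite Eq.
assert (U1 : K * J / (delta * theta) <= K * (PI / 2)).
{ apply (Rmult_le_reg_r (delta * theta)); [assumption|].
  replace (K * J / (delta * theta) * (delta * theta)) with (K * J) by (field; lra).
  rewrite Rmult_assoc. apply Rmult_le_compat_l; lra. }
assert (U2 : low delta <= K * J / (delta * theta)).
{ apply (Rmult_le_reg_r (delta * theta)); [assumption|].
  replace (K * J / (delta * theta) * (delta * theta)) with (K * J) by (field; lra).
  unfold low. rewrite Rmult_assoc. apply Rmult_le_compat_l; lra. }
apply Rabs_def2 in HU.
assert (U3 : K * (PI / 4 - I) < eps / 4).
{ replace (eps / 4) with (K * (eps / (4 * K))) by (field; lra). apply Rmult_lt_compat_l; lra. }
assert (0 < eps) by apply cond_pos.
apply Rabs_def1; lra.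
Qed.

(* I^4_{delta,b0,theta0} -> ineff(nu) as delta -> 0 (delta > 0). *)
Theorem theorem4p4 (nu b0 theta0 : R) :
  / 2 <= nu -> 0 < b0 -> 0 < theta0 ->
  limit1_in (fun delta => I4 nu delta b0 theta0) (fun delta => 0 < delta) (ineff nu) 0.
Proof.
intros Hn Hb Ht.
set (w := b0 ^ 2 * (2 * nu / theta0) ^ 2).
assert (Hw : 0 < w).
{ apply Rmult_lt_0_compat; apply pow_lt; [assumption | apply Rdiv_lt_0_compat; lra]. }
(* [v1] grows like [1 / alpha] and the information integral decays like [alpha], so the normalising
   factors cancel in [I4]. *)
assert (L : filterlim (fun delta => delta * theta0 * v1 nu delta b0 theta0 *
                        (info_integral nu delta theta0 b0 / (delta * theta0)) * / w)
              (at_right 0) (locally (ineff nu))).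
{ assert (E : ineff nu = 2 * b0 ^ 2 * C_nu nu ^ 2 * cauchy_int (2 * nu + 1) *
                         (((2 * nu + 1) / theta0) ^ 2 * (PI / 2)) * / w).
  { rewrite cauchy_int_Gamma by lra.
    replace (2 * nu + 1 - / 2) with (2 * nu + / 2) by field.
    destruct (Gamma_correct nu ltac:(lra)) as [_ G1].
    destruct (Gamma_correct (2 * nu + 1) ltac:(lra)) as [_ G2].
    assert (P := PI_RGT_0). assert (Q := sqrt_lt_R0 _ P).
    (* The [PI] of the information limit has to cancel the [sqrt PI] squared in [C_nu nu ^ 2], so it
       is written as a product of square roots for [field]. *)
    unfold ineff, C_nu, w. rewrite <- (sqrt_sqrt PI) at 4 by lra.
    field. repeat split; lra. }
  rewrite E. apply filterlim_Rmult; [|apply filterlim_const].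
  apply filterlim_Rmult; [now apply v1_limit | now apply info_integral_limit]. }
intros eps Heps.
destruct (proj1 (filterlim_locally _ _) L (mkposreal eps Heps)) as [d Hd].
exists d. split; [apply cond_pos|]. intros delta [H0 Hdist].
specialize (Hd delta Hdist H0). unfold dist; simpl.
replace (I4 nu delta b0 theta0) with (delta * theta0 * v1 nu delta b0 theta0 *
  (info_integral nu delta theta0 b0 / (delta * theta0)) * / w); [exact Hd|].
unfold I4, sigma4sq. fold w. fold (info_integral nu delta theta0 b0).
unfold Rdiv at 2. rewrite Rinv_mult, Rinv_inv. field. split; lra.
Qed.
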